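(* Let $p\in\mathbb{C}$, with class $p+\mathbb{Z}\in\mathbb{A}^1/\mathbb{Z}$. 1) There is an equivalence of categories $$\mathcal{M}^{(0,p+\mathbb{Z})}:\mathrm{Hol}(\mathcal{D}_{K_0})^{\mathrm{reg},(p)}\longrightarrow \mathrm{Mod}(\mathbb{C}[z-p])_{\mathrm{fin}}$$ and, for every $F\in\mathrm{Hol}(\mathcal{D}_{K_0})^{\mathrm{reg},(p)}$, an isomorphism of $\Delta$-modules, functorial in $F$, $$\mathcal{M}(\mathring{\jmath}_{0*}(F))\overset{\sim}{\longrightarrow}\iota_{p!}^{\to}\big(\mathcal{M}^{(0,p+\mathbb{Z})}(F)\big),$$ which is a homeomorphism for the natural topologies, i.e. the $\tau$-adic topologies. This determines $\mathcal{M}^{(0,p+\mathbb{Z})}$ up to natural isomorphism. 2) There is an equivalence of categories $$\mathcal{M}^{(\infty,p+\mathbb{Z})}:\mathrm{Hol}(\mathcal{D}_{K_\infty})^{\mathrm{reg},(-p)}\longrightarrow \mathrm{Mod}(\mathbb{C}[z-p])_{\mathrm{fin}}$$ and, for every $F\in\mathrm{Hol}(\mathcal{D}_{K_\infty})^{\mathrm{reg},(-p)}$, an isomorphism of $\Delta$-modules, functorial in $F$, $$\mathcal{M}(\mathring{\jmath}_{\infty*}(F))\overset{\sim}{\longrightarrow}\iota_{p!}^{\leftarrow}\big(\mathcal{M}^{(\infty,p+\mathbb{Z})}(F)\big),$$ which is a homeomorphism for the natural topologies, i.e. the $\tau^{-1}$-adic topologies. This determines $\mathcal{M}^{(\infty,p+\mathbb{Z})}$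 up to natural isomorphism.
   Context: $\Delta=\mathbb{C}[z]\langle\tau,\tau^{-1}\rangle$ with $\tau z=(z-1)\tau$. $\mathcal{D}=\mathbb{C}[x,x^{-1}]\langle\partial\rangle$, $\partial x=x\partial+1$. The Mellin transform $\mathcal{M}:\mathrm{Mod}(\mathcal{D})\to\mathrm{Mod}(\Delta)$ is the equivalence induced by the ring isomorphism $\mathcal{D}\cong\Delta$, $x\mapsto\tau$, $x\partial\mapsto z$ (the underlying vector space does not change). $\mathcal{D}_{K_0}=\mathbb{C}((x))\langle\partial\rangle$, and $\mathrm{Hol}(\mathcal{D}_{K_0})$ is the category of $\mathcal{D}_{K_0}$-modules that are finite dimensional over $\mathbb{C}((x))$. Similarly, with $y=x^{-1}$, $\mathcal{D}_{K_\infty}=\mathbb{C}((y))\langle\partial_y\rangle$ (so $x\partial=-y\partial_y$) and $\mathrm{Hol}(\mathcal{D}_{K_\infty})$ is the category of modules finite dimensional over $\mathbb{C}((y))$. For $q\in\mathbb{C}$, $\mathrm{Hol}(\mathcal{D}_{K_0})^{\mathrm{reg},(q)}$ is the full subcategory of regular singular modules with leading term in $q+\mathbb{Z}$: those $F$ having a $\mathbb{C}[[x]]$-lattice $L$ stable under $x\partial$ with $(x\partial-q)^nL\subseteq xL$ for some $n$. $\mathrm{Hol}(\mathcal{D}_{K_\infty})^{\mathrm{reg},(q)}$ is defined in the same way in the coordinate $y$ (with $y\partial_y$ in place of $x\partial$). $\mathring{\jmath}_{0*}$ and $\mathring{\jmath}_{\infty*}$ are the forgetful functors from $\mathcal{D}_{K_0}$-modules,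 resp. $\mathcal{D}_{K_\infty}$-modules, to $\mathcal{D}$-modules. $\mathrm{Mod}(\mathbb{C}[z-p])_{\mathrm{fin}}$ is the category of finite length $\mathbb{C}[[z-p]]$-modules, i.e. finite-dimensional $\mathbb{C}[z-p]$-modules on which $\pi=z-p$ acts nilpotently. For $N$ in this category, $\iota_{p!}^{\to}(N)=\mathbb{C}((\tau))\otimes_{\mathbb{C}}N$, with $\tau$ acting by multiplication and $$z\Big(\big(\sum_n a_n\tau^n\big)\otimes m\Big)=\Big(\sum_n(p+n)a_n\tau^n\Big)\otimes m+\Big(\sum_n a_n\tau^n\Big)\otimes\pi m .$$ $\iota_{p!}^{\leftarrow}(N)=\mathbb{C}((\tau^{-1}))\otimes_{\mathbb{C}}N$ with the action given by the same formula. Topology: for a module over $\mathbb{C}[\tau]$, the $\tau$-adic topology has as a basis of neighborhoods of $0$ the open subspaces, where a subspace $U$ is open if for every finitely generated $\mathbb{C}[\tau]$-submodule $N'$ there is $k$ with $\tau^kN'\subseteq U$ (for $M=\mathcal{M}(F)$ with $F$ over $\mathbb{C}((x))$ or $\iota^{\to}_{p!}N$, one uses $\mathbb{C}[[\tau]]$-submodules $N'$; this is the usual lattice topology on a finite-dimensional $\mathbb{C}((\tau))$-vector space). The $\tau^{-1}$-adic topology is the analogue with $\tau^{-1}$ in place of $\tau$. *)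

(* Defs.v *)
From HB Require Import structures.
From mathcomp Require Import all_boot all_order all_algebra.
From mathcomp Require Import mathcomp_extra boolp classical_sets functions.
From mathcomp Require Import cardinality fsbigop reals topology_structure.
From mathcomp Require Import zify.
From mathcomp Require Import complex.

Set Implicit Arguments.
Unset Strict Implicit.
Unset Printing Implicit Defensive.

Import Order.TTheory GRing.Theory Num.Theory.

Local Open Scope classical_set_scope.
Local Open Scope ring_scope.

(* [f n] is the coefficient of $t^n$ in [f : laurent k]. *)
Record laurent (k : fieldType) := Laurent {
  lcoef :> int -> k;
  lcoef_bounded : exists N : int, forall n, n < N -> lcoef n = 0
}.

HB.instance Definition _ (k : fieldType) := gen_eqMixin (laurent k).
HB.instance Definition _ (k : fieldType) := gen_choiceMixin (laurent k).

Section LaurentRing.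
Variable k : fieldType.
Implicit Types (f g h : laurent k) (c : int -> k) (n m : int).

Lemma laurentP f g : f =1 g -> f = g.
Proof.
case: f g => [f hf] [g hg] /= /funext efg.
by move: hf hg; rewrite efg => hf hg; congr Laurent; exact: Prop_irrelevance.
Qed.

Definition vanish_below c n := forall i, i < n -> c i = 0.

Fact lzero_subproof : exists n, vanish_below (fun=> 0) n.
Proof. by exists 0. Qed.
Definition lzero : laurent k := Laurent lzero_subproof.

Fact ladd_subproof f g : exists n, vanish_below (fun i => f i + g i) n.
Proof.
have [[a fa] [b gb]] := (lcoef_bounded f, lcoef_bounded g).
by exists (Num.min a b) => i; rewrite lt_min => /andP[/fa-> /gb->]; rewrite addr0.
Qed.
Definition ladd f g := Laurent (ladd_subproof f g).

Fact lopp_subproof f : exists n, vanish_below (fun i => - f i) n.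
Proof. by have [a fa] := lcoef_bounded f; exists a => i /fa->; rewrite oppr0. Qed.
Definition lopp f := Laurent (lopp_subproof f).

Fact laddA : associative ladd.
Proof. by move=> f g h; apply: laurentP => n /=; rewrite addrA. Qed.
Fact laddC : commutative ladd.
Proof. by move=> f g; apply: laurentP => n /=; rewrite addrC. Qed.
Fact ladd0 : left_id lzero ladd.
Proof. by move=> f; apply: laurentP => n /=; rewrite add0r. Qed.
Fact laddN : left_inverse lzero lopp ladd.
Proof. by move=> f; apply: laurentP => n /=; rewrite addNr. Qed.

HB.instance Definition _ :=
  GRing.isZmodule.Build (laurent k) laddA laddC ladd0 laddN.

Lemma lcoef0 n : (0 : laurent k) n = 0. Proof. by []. Qed.
Lemma lcoefD f g n : (f + g) n = f n + g n. Proof. by []. Qed.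
Lemma lcoefN f n : (- f) n = - f n. Proof. by []. Qed.

Definition lmul_coef f g n : k := \sum_(i \in [set: int]) f i * g (n - i).

Lemma lmul_coefE f g n a b (m : nat) :
    vanish_below f a -> vanish_below g b -> n - a - b < m%:Z ->
  lmul_coef f g n = \sum_(i < m) f (a + i%:Z) * g (n - a - i%:Z).
Proof.
move=> fa gb ltm; pose r := [seq a + i%:Z | i <- iota 0 m].
rewrite /lmul_coef (@fsbigE _ _ _ _ _ r) //; first last.
- move=> i _; case: (ltP i a) => [/fa->|lea]; first by rewrite mul0r.
  move=> /mapP nr; rewrite gb ?mulr0//; rewrite ltNge; apply/negP => leb.
  apply: nr; exists (absz (i - a)%R); last by lia.
  by rewrite mem_iota; lia.
- rewrite map_inj_uniq ?iota_uniq// => i j; lia.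
rewrite big_map -{1}[m]subn0 -/(index_iota 0 m) big_mkord.
by apply: eq_big => [i|i _]; [rewrite in_setT | rewrite opprD addrA].
Qed.

Lemma lmul_vanish f g a b : vanish_below f a -> vanish_below g b ->
  vanish_below (lmul_coef f g) (a + b).
Proof.
move=> fa gb n ltn; rewrite (@lmul_coefE _ _ _ a b 0)// ?big_ord0//; lia.
Qed.

Fact lmul_subproof f g : exists n, vanish_below (lmul_coef f g) n.
Proof.
have [[a fa] [b gb]] := (lcoef_bounded f, lcoef_bounded g).
by exists (a + b); exact: lmul_vanish.
Qed.
Definition lmul f g := Laurent (lmul_subproof f g).

Fact lmono_subproof m :
  exists n, vanish_below (fun n : int => (n == m)%:R) n.
Proof. by exists m => i; rewrite lt_neqAle => /andP[/negPf->]. Qed.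
(* [lmono m] is the monomial $t^m$ *)
Definition lmono m := Laurent (lmono_subproof m).

Lemma lmulA : associative lmul.
Proof.
move=> f g h; apply: laurentP => n /=.
have [[a fa] [[b gb] [c hc]]] :=
  (lcoef_bounded f, (lcoef_bounded g, lcoef_bounded h)).
pose m := (absz (n - a - b - c)%R).+1.
have ltm : n - a - b - c < m%:Z by rewrite /m; lia.
rewrite (@lmul_coefE _ _ _ a (b + c) m)//; last 2 first.
- exact: lmul_vanish.
- lia.
rewrite (@lmul_coefE _ _ _ (a + b) c m)//; last 2 first.
- exact: lmul_vanish.
- lia.
under [RHS]eq_bigr => i _.
  rewrite /= (@lmul_coefE _ _ _ a b m)//; last by have := ltn_ord i; lia.
  rewrite big_distrl; over.
rewrite exchange_big; apply: eq_bigr => j _ /=.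
rewrite (@lmul_coefE g h (n - a - j%:Z) (b - j%:Z) c m)//; last 2 first.
- by move=> i lti; apply: gb; lia.
- lia.
rewrite big_distrr; apply: eq_bigr => i _ /=; rewrite mulrA.
by congr (_ * g _ * h _); lia.
Qed.

Lemma lmulC : commutative lmul.
Proof.
move=> f g; apply: laurentP => n /=.
have [[a fa] [b gb]] := (lcoef_bounded f, lcoef_bounded g).
case: (ltP n (a + b)) => [ltn|len].
  by rewrite (lmul_vanish fa gb)// (lmul_vanish gb fa)// addrC.
pose m := (absz (n - a - b)%R).+1.
rewrite (@lmul_coefE _ _ _ a b m)//; last by rewrite /m; lia.
rewrite (@lmul_coefE _ _ _ b a m)//; last by rewrite /m; lia.
rewrite (reindex_inj rev_ord_inj); apply: eq_bigr => i _ /=.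
rewrite mulrC; congr (g _ * f _); have := ltn_ord i; rewrite /m; lia.
Qed.

Lemma lmul_mono m f n : lmul (lmono m) f n = f (n - m).
Proof.
have [b fb] := lcoef_bounded f.
rewrite /= (@lmul_coefE _ _ _ m b (absz (n - m - b)%R).+1)//; last 2 first.
- by move=> i; rewrite /= lt_neqAle => /andP[/negPf->].
- lia.
rewrite big_ord_recl /= addr0 eqxx mul1r subr0 big1 ?addr0// => i _.
by rewrite /= -subr_eq0 addrC addKr mul0r.
Qed.

Fact lmul1 : left_id (lmono 0) lmul.
Proof. by move=> f; apply: laurentP => n; rewrite lmul_mono subr0. Qed.

Fact lmulDl : left_distributive lmul +%R.
Proof.
move=> f g h; apply: laurentP => n /=.
have [[a fa] [[b gb] [c hc]]] :=
  (lcoef_bounded f, (lcoef_bounded g, lcoef_bounded h)).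
pose d := Num.min a b; pose m := (absz (n - d - c)%R).+1.
have fd : vanish_below f d by move=> i; rewrite lt_min => /andP[/fa].
have gd : vanish_below g d by move=> i; rewrite lt_min => /andP[_ /gb].
have fgd : vanish_below (f + g) d by move=> i lt; rewrite lcoefD fd// gd// addr0.
have ltm : n - d - c < m%:Z by rewrite /m; lia.
rewrite !(@lmul_coefE _ h n d c m)// -big_split.
by apply: eq_bigr => i _; rewrite lcoefD mulrDl.
Qed.

Fact lone_neq0 : lmono 0 != 0.
Proof.
apply/eqP => /(congr1 (fun f : laurent k => f 0)) /=.
by move=> /eqP; rewrite oner_eq0.
Qed.

HB.instance Definition _ := GRing.Zmodule_isComNzRing.Build (laurent k)
  lmulA lmulC lmul1 lmulDl lone_neq0.

Lemma lcoefM f g n : (f * g) n = lmul_coef f g n. Proof. by []. Qed.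
Lemma lmono0 : lmono 0 = 1. Proof. by []. Qed.

Lemma lcoef_monoM m f n : (lmono m * f) n = f (n - m).
Proof. exact: lmul_mono. Qed.

Lemma lmonoD m n : lmono (m + n) = lmono m * lmono n.
Proof. by apply: laurentP => i; rewrite lcoef_monoM /= subr_eq addrC. Qed.

Fixpoint linv_seq (u : nat -> k) (n : nat) : seq k :=
  if n is n'.+1 then
    let s := linv_seq u n' in
    rcons s (((n' == 0%N)%:R - \sum_(i < n') s`_i * u (n' - i)%N) / u 0%N)
  else [::].

Lemma size_linv_seq u (n : nat) : size (linv_seq u n) = n.
Proof. by elim: n => //= n IHn; rewrite size_rcons IHn. Qed.

Lemma linv_seqE u (n m i : nat) : (i < n)%N -> (i < m)%N ->
  (linv_seq u n)`_i = (linv_seq u m)`_i.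
Proof.
suff H d : (i < n)%N -> (linv_seq u (d + n))`_i = (linv_seq u n)`_i.
  move=> ltn ltm; case: (leqP n m) => [/subnK<-|/ltnW/subnK e].
    by rewrite H.
  rewrite -e; elim: (n - m)%N => // d IHd.
  by rewrite addSn /= nth_rcons size_linv_seq ltn_addl.
elim: d => // d IHd lti; rewrite addSn /= nth_rcons size_linv_seq.
by rewrite ltn_addl// IHd.
Qed.

Lemma linv_exists f : f != 0 -> exists g, g * f = 1.
Proof.
move=> f0; have [a fa] := lcoef_bounded f.
have [i fi] : exists i, f i != 0.
  apply: contrapT => /forallNP fN; move/eqP: f0; apply.
  by apply: laurentP => i; apply/eqP/negPn/negP/fN.
have ex : exists j : nat, f (a + j%:Z) != 0.
  exists (absz (i - a)%R); rewrite (_ : a + _ = i)//.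
  case: (ltP i a) => [/fa fi0|]; last lia.
  by rewrite fi0 eqxx in fi.
case: (ex_minnP ex) => j fj minj; pose v := a + j%:Z.
have fv : vanish_below f v.
  move=> l ltl; case: (ltP l a) => [/fa//|lea]; apply/eqP/negPn/negP => fl.
  have := minj (absz (l - a)%R); rewrite (_ : a + _ = l); last lia.
  by move=> /(_ fl); rewrite /v in ltl; lia.
pose u (n : nat) := f (v + n%:Z).
have u0 : u 0%N != 0 by rewrite /u addr0.
pose c (n : int) : k :=
  if n + v is Posz l then (linv_seq u l.+1)`_l else 0.
have cV : vanish_below c (- v).
  by move=> l ltl; rewrite /c; case E: (l + v) => [l'|]//; lia.
have cE (l : nat) : c (- v + l%:Z) = (linv_seq u l.+1)`_l.
  by rewrite /c (_ : _ + v = l%:Z)//; lia.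
pose g := Laurent (ex_intro _ _ cV); exists g; apply: laurentP => n.
rewrite lcoefM; case: (ltP n 0) => [n0|].
  rewrite (@lmul_vanish g f (- v) v)// ?addNr//.
  by rewrite /= lt_eqF.
case: n => // n _; rewrite (@lmul_coefE g f n (- v) v n.+1)//; last lia.
under eq_bigr => l _.
  rewrite /= cE (@linv_seqE _ _ n.+1)// (_ : f _ = u (n - l)%N); last first.
    by rewrite /u; congr (f _); have := ltn_ord l; lia.
  over.
rewrite big_ord_recr /= subnn nth_rcons size_linv_seq ltnn eqxx.
rewrite divfK// addrC -addrA.
rewrite [X in _ + X](_ : _ = 0) ?addr0// addrC; apply/eqP; rewrite subr_eq0.
by apply/eqP/eq_bigr => l _; rewrite nth_rcons size_linv_seq ltn_ord.
Qed.

Definition linv f : laurent k := xget 0 [set g | g * f = 1].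

Fact lmulVf f : f != 0 -> linv f * f = 1.
Proof.
by move=> /linv_exists[g gf]; rewrite /linv; case: xgetP => // /(_ g) /(_ gf).
Qed.

Fact linv0 : linv 0 = 0.
Proof.
rewrite /linv; case: xgetP => // g _ /eqP; rewrite mulr0 eq_sym.
by rewrite oner_eq0.
Qed.

HB.instance Definition _ :=
  GRing.ComNzRing_isField.Build (laurent k) lmulVf linv0.

(* $\sum_n a_n t^n \mapsto \sum_n c_n a_n t^n$ *)
Fact lhad_subproof c f : exists n, vanish_below (fun i => c i * f i) n.
Proof. by have [a fa] := lcoef_bounded f; exists a => i /fa->; rewrite mulr0. Qed.
Definition lhad c f := Laurent (lhad_subproof c f).

Lemma lcoef_had c f n : lhad c f n = c n * f n. Proof. by []. Qed.

Definition lscale (a : k) f := lhad (fun=> a) f.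

Fact lscaleA a b f : lscale a (lscale b f) = lscale (a * b) f.
Proof. by apply: laurentP => n /=; rewrite mulrA. Qed.
Fact lscale1 : left_id 1 lscale.
Proof. by move=> f; apply: laurentP => n /=; rewrite mul1r. Qed.
Fact lscaleDr : right_distributive lscale +%R.
Proof. by move=> a f g; apply: laurentP => n /=; rewrite mulrDr. Qed.
Fact lscaleDl f : {morph lscale^~ f : a b / a + b}.
Proof. by move=> a b; apply: laurentP => n /=; rewrite mulrDl. Qed.
HB.instance Definition _ := GRing.Zmodule_isLmodule.Build k (laurent k)
  lscaleA lscale1 lscaleDr lscaleDl.

Lemma lcoefZ a f n : (a *: f) n = a * f n. Proof. by []. Qed.

Fact lscaleAl (a : k) f g : a *: (f * g) = (a *: f) * g.
Proof.
apply: laurentP => n.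
have [[b fb] [c gc]] := (lcoef_bounded f, lcoef_bounded g).
have afb : vanish_below (a *: f) b by move=> i /fb; rewrite lcoefZ => ->; rewrite mulr0.
pose m := (absz (n - b - c)%R).+1; have ltm : n - b - c < m%:Z by rewrite /m; lia.
rewrite lcoefZ !lcoefM !(@lmul_coefE _ g n b c m)// big_distrr.
by apply: eq_bigr => i _; rewrite /= mulrA.
Qed.
HB.instance Definition _ :=
  GRing.Lmodule_isLalgebra.Build k (laurent k) lscaleAl.
HB.instance Definition _ := GRing.Lalgebra_isComAlgebra.Build k (laurent k).

Fact lderiv_subproof f :
  exists n, vanish_below (fun n => (n + 1)%:~R * f (n + 1)) n.
Proof.
have [a fa] := lcoef_bounded f; exists (a - 1) => i lti.
by rewrite fa ?mulr0//; lia.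
Qed.
Definition lderiv f := Laurent (lderiv_subproof f).

Lemma lderiv_mono m : lderiv (lmono m) = m%:~R *: lmono (m - 1).
Proof.
apply: laurentP => n; rewrite lcoefZ /= eq_sym -subr_eq eq_sym.
by case: eqP => [->|_]; rewrite ?subrK ?mulr0.
Qed.

Lemma lderivZ a f : lderiv (a *: f) = a *: lderiv f.
Proof. by apply: laurentP => n; rewrite lcoefZ /= mulrCA. Qed.

Lemma lderivM f g : lderiv (f * g) = lderiv f * g + f * lderiv g.
Proof.
have [[a fa] [b gb]] := (lcoef_bounded f, lcoef_bounded g).
have dfa : vanish_below (lderiv f) (a - 1).
  by move=> i lti; rewrite /= fa ?mulr0//; lia.
have dgb : vanish_below (lderiv g) (b - 1).
  by move=> i lti; rewrite /= gb ?mulr0//; lia.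
apply: laurentP => n; pose m := (absz (n + 1 - a - b)%R).+1.
have ltm : n + 1 - a - b < m%:Z by rewrite /m; lia.
rewrite lcoefD -[LHS]/((n + 1)%:~R * (f * g) (n + 1)) !lcoefM.
rewrite (@lmul_coefE f g (n + 1) a b m)//.
rewrite (@lmul_coefE _ g n (a - 1) b m)//; last by lia.
rewrite (@lmul_coefE f _ n a (b - 1) m)//; last by lia.
rewrite big_distrr -big_split; apply: eq_bigr => i _ /=.
rewrite (_ : a - 1 + i%:Z + 1 = a + i%:Z); last by lia.
rewrite (_ : n - (a - 1) - i%:Z = n + 1 - a - i%:Z); last by lia.
rewrite (_ : n - a - i%:Z + 1 = n + 1 - a - i%:Z); last by lia.
rewrite (mulrCA (f _)) -mulrA -mulrDl -intrD.
by congr (_%:~R * _); lia.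
Qed.

Definition is_pseries f := vanish_below f 0.

End LaurentRing.

Definition restr (k : fieldType) (A : algType k) (V : lmodType A) : Type := V.

Section Restr.
Variables (k : fieldType) (A : algType k) (V : lmodType A).

HB.instance Definition _ := GRing.Zmodule.copy (restr V) V.

Let scale (a : k) (v : restr V) : restr V := (a%:A : A) *: (v : V).

Fact restr_scaleA a b v : scale a (scale b v) = scale (a * b) v.
Proof. by rewrite /scale scalerA -scalerAl mul1r scalerA. Qed.
Fact restr_scale1 : left_id 1 scale.
Proof. by move=> v; rewrite /scale !scale1r. Qed.
Fact restr_scaleDr : right_distributive scale +%R.
Proof. by move=> a u v; rewrite /scale scalerDr. Qed.
Fact restr_scaleDl v : {morph scale^~ v : a b / a + b}.
Proof. by move=> a b; rewrite /scale !scalerDl. Qed.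
HB.instance Definition _ := GRing.Zmodule_isLmodule.Build k (restr V)
  restr_scaleA restr_scale1 restr_scaleDr restr_scaleDl.

Lemma restr_scaleE (a : k) (v : restr V) :
  a *: v = (a%:A : A) *: (v : V) :> V.
Proof. by []. Qed.

End Restr.

Section Tensor.
Variables (k : fieldType) (U W : lmodType k).

Definition bilin (V : lmodType k) (h : U -> W -> V) : Prop :=
  (forall w, linear (h^~ w)) /\ (forall u, linear (h u)).

Definition tsum (V : lmodType k) (h : U -> W -> V) (s : seq (U * W)) : V :=
  \sum_(uw <- s) h uw.1 uw.2.

(* A list [:: (u_1, w_1); ...; (u_r, w_r)] stands for the formal sum
   $\sum_i u_i \otimes w_i$; two formal sums are identified when no bilinear
   map separates them. *)
Definition tensor_rel (s s' : seq (U * W)) : bool :=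
  `[< forall (V : lmodType k) (h : U -> W -> V), bilin h ->
        tsum h s = tsum h s' >].

Fact tensor_rel_equiv : equiv_class_of tensor_rel.
Proof.
split=> [s|s s'|s2 s1 s3].
- by apply/asboolP.
- by apply/asboolP/asboolP => H V h bh; rewrite H.
- by move=> /asboolP H1 /asboolP H2; apply/asboolP => V h bh; rewrite H1 ?H2.
Qed.
Canonical tensor_equiv := EquivRelPack tensor_rel_equiv.

Definition tensor : Type := {eq_quot tensor_rel}%qT.
HB.instance Definition _ := Choice.on tensor.
HB.instance Definition _ := Quotient.on tensor.

Definition tlift (V : lmodType k) (h : U -> W -> V) (x : tensor) : V :=
  tsum h (repr x).

Lemma tlift_pi (V : lmodType k) (h : U -> W -> V) s :
  bilin h -> tlift h (\pi_tensor s)%qT = tsum h s.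
Proof.
move=> bh; rewrite /tlift.
have : (repr (\pi_tensor s) = s %[mod {eq_quot tensor_rel}])%qT.
  exact: (reprK (\pi_tensor s)%qT).
by move/eqmodP/asboolP; apply.
Qed.

Lemma tensor_ext (x y : tensor) :
  (forall (V : lmodType k) (h : U -> W -> V), bilin h ->
     tlift h x = tlift h y) -> x = y.
Proof.
move=> H; rewrite -[x]reprK -[y]reprK; apply/eqmodP/asboolP => V h bh.
exact: H.
Qed.

Let tzero : tensor := (\pi_tensor [::])%qT.
Let tadd (x y : tensor) : tensor := (\pi_tensor (repr x ++ repr y))%qT.
Let tscale (a : k) (x : tensor) : tensor :=
  (\pi_tensor [seq (a *: uw.1, uw.2) | uw <- repr x])%qT.

Fact tlift0_ (V : lmodType k) (h : U -> W -> V) : bilin h -> tlift h tzero = 0.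
Proof. by move=> bh; rewrite tlift_pi// /tsum big_nil. Qed.
Fact tliftD_ (V : lmodType k) (h : U -> W -> V) x y : bilin h ->
  tlift h (tadd x y) = tlift h x + tlift h y.
Proof. by move=> bh; rewrite tlift_pi// /tsum big_cat. Qed.

Lemma bilin0l (V : lmodType k) (h : U -> W -> V) w : bilin h -> h 0 w = 0.
Proof.
move=> [/(_ w) hl _]; have := hl (-1) 0 0.
by rewrite scaler0 addr0 scaleN1r addNr.
Qed.

Lemma bilinZl (V : lmodType k) (h : U -> W -> V) a u w : bilin h ->
  h (a *: u) w = a *: h u w.
Proof.
move=> bh; have [/(_ w) hl _] := bh.
by have := hl a u 0; rewrite addr0 /= (bilin0l w bh) addr0.
Qed.

Fact tliftZ_ (V : lmodType k) (h : U -> W -> V) a x : bilin h ->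
  tlift h (tscale a x) = a *: tlift h x.
Proof.
move=> bh; rewrite tlift_pi// /tsum big_map scaler_sumr.
by apply: eq_bigr => i _; rewrite bilinZl.
Qed.

Let liftE := (tlift0_, tliftD_, tliftZ_).

Fact taddA : associative tadd.
Proof. by move=> x y z; apply: tensor_ext => V h bh; rewrite !liftE// addrA. Qed.
Fact taddC : commutative tadd.
Proof. by move=> x y; apply: tensor_ext => V h bh; rewrite !liftE// addrC. Qed.
Fact tadd0 : left_id tzero tadd.
Proof. by move=> x; apply: tensor_ext => V h bh; rewrite !liftE// add0r. Qed.
Fact taddN : left_inverse tzero (tscale (-1)) tadd.
Proof.
move=> x; apply: tensor_ext => V h bh.
by rewrite !liftE// scaleN1r addNr.
Qed.
HB.instance Definition _ := GRing.isZmodule.Build tensor taddA taddC tadd0 taddN.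

Fact tscaleA a b x : tscale a (tscale b x) = tscale (a * b) x.
Proof. by apply: tensor_ext => V h bh; rewrite !liftE// scalerA. Qed.
Fact tscale1 : left_id 1 tscale.
Proof. by move=> x; apply: tensor_ext => V h bh; rewrite !liftE// scale1r. Qed.
Fact tscaleDr : right_distributive tscale +%R.
Proof. by move=> a x y; apply: tensor_ext => V h bh; rewrite !liftE// scalerDr. Qed.
Fact tscaleDl x : {morph tscale^~ x : a b / a + b}.
Proof. by move=> a b; apply: tensor_ext => V h bh; rewrite !liftE// scalerDl. Qed.
HB.instance Definition _ := GRing.Zmodule_isLmodule.Build k tensor
  tscaleA tscale1 tscaleDr tscaleDl.

Definition tpure (u : U) (w : W) : tensor := (\pi_tensor [:: (u, w)])%qT.

Lemma tlift_linear (V : lmodType k) (h : U -> W -> V) :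
  bilin h -> linear (tlift h).
Proof. by move=> bh a x y; rewrite tliftD_// tliftZ_. Qed.

Lemma tlift_pure (V : lmodType k) (h : U -> W -> V) u w :
  bilin h -> tlift h (tpure u w) = h u w.
Proof. by move=> bh; rewrite tlift_pi// /tsum big_seq1. Qed.

Lemma tpure_bilin : bilin tpure.
Proof.
split=> [w a u u'|u a w w']; apply: tensor_ext => V h bh;
  rewrite tlift_linear// !tlift_pure//.
- exact: bh.1.
- exact: bh.2.
Qed.

Lemma tensor_sumE (x : tensor) : x = \sum_(uw <- repr x) tpure uw.1 uw.2.
Proof.
apply: tensor_ext => V h bh; pose g := HB.pack_for {linear tensor -> V} (tlift h)
  (GRing.isLinear.Build _ _ _ _ _ (tlift_linear bh)).
rewrite -[RHS]/(g _) raddf_sum /tlift /tsum.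
by apply: eq_bigr => i _; rewrite /= tlift_pure.
Qed.

Lemma tensor_lin_ext (V : lmodType k) (f g : tensor -> V) :
    linear f -> linear g -> (forall u w, f (tpure u w) = g (tpure u w)) ->
  f =1 g.
Proof.
move=> lf lg efg x.
pose f' := HB.pack_for {linear tensor -> V} f
  (GRing.isLinear.Build _ _ _ _ _ lf).
pose g' := HB.pack_for {linear tensor -> V} g
  (GRing.isLinear.Build _ _ _ _ _ lg).
rewrite -[f x]/(f' x) -[g x]/(g' x) (tensor_sumE x) !raddf_sum.
by apply: eq_bigr => i _; exact: efg.
Qed.

Lemma tensor_universal (V : lmodType k) (h : U -> W -> V) : bilin h ->
  exists! g : tensor -> V, linear g /\ (forall u w, g (tpure u w) = h u w).
Proof.
move=> bh; exists (tlift h); split=> [|g [lg gE]].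
  by split; [exact: tlift_linear | move=> u w; exact: tlift_pure].
apply/funext; apply: tensor_lin_ext => //; first exact: tlift_linear.
by move=> u w; rewrite tlift_pure.
Qed.

End Tensor.

Arguments tpure {k U W}.

Record category := Category {
  object :> Type;
  hom : object -> object -> Type;
  idm : forall A, hom A A;
  mcomp : forall A B C, hom B C -> hom A B -> hom A C;
  mcomp1m : forall A B (f : hom A B), mcomp (idm B) f = f;
  mcompm1 : forall A B (f : hom A B), mcomp f (idm A) = f;
  mcompA : forall A B C D (f : hom C D) (g : hom B C) (h : hom A B),
    mcomp f (mcomp g h) = mcomp (mcomp f g) h
}.
Arguments idm {c} A.
Arguments mcomp {c A B C}.

Record functor (C D : category) := Functor {
  fobj :> C -> D;
  fmap : forall A B, hom A B -> hom (fobj A) (fobj B);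
  fmap1 : forall A, fmap (idm A) = idm (fobj A);
  fmapM : forall A1 A2 A3 (f : hom A2 A3) (g : hom A1 A2),
    fmap (mcomp f g) = mcomp (fmap f) (fmap g)
}.
Arguments fmap {C D} f {A B} u : rename.

Definition functor_id (C : category) : functor C C :=
  @Functor C C id (fun _ _ f => f) (fun=> erefl) (fun _ _ _ _ _ => erefl).

Section FunctorComp.
Variables (C D E : category) (G : functor D E) (F : functor C D).

Fact functor_comp1 A : fmap G (fmap F (idm A)) = idm (G (F A)).
Proof. by rewrite !fmap1. Qed.
Fact functor_compM A1 A2 A3 (f : hom A2 A3) (g : hom A1 A2) :
  fmap G (fmap F (mcomp f g)) = mcomp (fmap G (fmap F f)) (fmap G (fmap F g)).
Proof. by rewrite !fmapM. Qed.
Definition functor_comp : functor C E :=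
  @Functor C E (fun A => G (F A)) (fun _ _ f => fmap G (fmap F f))
    functor_comp1 functor_compM.

End FunctorComp.

Definition is_iso (C : category) (A B : C) (f : hom A B) : Prop :=
  exists g : hom B A, mcomp g f = idm A /\ mcomp f g = idm B.

Record nat_iso (C D : category) (F G : functor C D) := NatIso {
  niso :> forall A, hom (F A) (G A);
  niso_natural : forall A B (u : hom A B),
    mcomp (fmap G u) (niso A) = mcomp (niso B) (fmap F u);
  niso_iso : forall A, is_iso (niso A)
}.

Definition is_equivalence (C D : category) (F : functor C D) : Prop :=
  exists G : functor D C,
    inhabited (nat_iso (functor_comp G F) (functor_id C)) /\
    inhabited (nat_iso (functor_comp F G) (functor_id D)).

Section FullSubcategory.
Variables (C : category) (P : C -> Prop).

Definition full_subcat : category :=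
  @Category {A : C | P A} (fun A B => hom (sval A) (sval B))
    (fun A => idm (sval A)) (fun _ _ _ f g => mcomp f g)
    (fun _ _ f => mcomp1m f) (fun _ _ f => mcompm1 f)
    (fun _ _ _ _ f g h => mcompA f g h).

Definition full_incl : functor full_subcat C :=
  @Functor full_subcat C (fun A => sval A) (fun _ _ f => f)
    (fun=> erefl) (fun _ _ _ _ _ => erefl).

End FullSubcategory.

Section Concrete.
Variables (O : Type) (car : O -> Type)
  (P : forall A B, (car A -> car B) -> Prop).
Hypothesis P1 : forall A, P (@id (car A)).
Hypothesis PM : forall A B C (f : car B -> car C) (g : car A -> car B),
  P f -> P g -> P (f \o g).

Lemma concrete_homP A B (f g : {f : car A -> car B | P f}) :
  sval f = sval g -> f = g.
Proof. exact: eq_sig_hprop => ? ? ?; exact: Prop_irrelevance. Qed.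

Let Hom A B := {f : car A -> car B | P f}.
Let id1 A : Hom A A := exist _ _ (P1 A).
Let compM A B C (f : Hom B C) (g : Hom A B) : Hom A C :=
  exist _ _ (PM (svalP f) (svalP g)).

Fact concrete1m A B (f : Hom A B) : compM (id1 B) f = f.
Proof. exact: concrete_homP. Qed.
Fact concretem1 A B (f : Hom A B) : compM f (id1 A) = f.
Proof. exact: concrete_homP. Qed.
Fact concreteA A B C D (f : Hom C D) (g : Hom B C) (h : Hom A B) :
  compM f (compM g h) = compM (compM f g) h.
Proof. exact: concrete_homP. Qed.

Definition concrete : category := Category concrete1m concretem1 concreteA.

End Concrete.

Section ConcreteFunctor.
Variables (O O' : Type) (car : O -> Type) (car' : O' -> Type).
Variables (P : forall A B, (car A -> car B) -> Prop)
  (P' : forall A B, (car' A -> car' B) -> Prop).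
Variables (P1 : forall A, P (@id (car A)))
  (PM : forall A B C (f : car B -> car C) (g : car A -> car B),
     P f -> P g -> P (f \o g)).
Variables (P1' : forall A, P' (@id (car' A)))
  (PM' : forall A B C (f : car' B -> car' C) (g : car' A -> car' B),
     P' f -> P' g -> P' (f \o g)).
Variables (ob : O -> O')
  (mor : forall A B, (car A -> car B) -> car' (ob A) -> car' (ob B)).
Hypothesis morP : forall A B (f : car A -> car B), P f -> P' (mor f).
Hypothesis mor1 : forall A, mor (@id (car A)) =1 id.
Hypothesis morM : forall A B C (f : car B -> car C) (g : car A -> car B),
  P f -> P g -> mor (f \o g) =1 mor f \o mor g.

Let cmor A B (f : @hom (concrete P1 PM) A B) :
    @hom (concrete P1' PM') (ob A) (ob B) :=
  exist _ (mor (sval f)) (morP (svalP f)).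

Fact concrete_functor1 A : cmor (idm A) = @idm (concrete P1' PM') (ob A).
Proof. by apply: concrete_homP; apply/funext => x /=; rewrite mor1. Qed.
Fact concrete_functorM A B C (f : @hom (concrete P1 PM) B C)
    (g : @hom (concrete P1 PM) A B) :
  cmor (mcomp f g) = mcomp (cmor f) (cmor g).
Proof.
by apply: concrete_homP; apply/funext => x /=; rewrite morM//; exact: svalP.
Qed.

Definition concrete_functor : functor (concrete P1 PM) (concrete P1' PM') :=
  @Functor (concrete P1 PM) (concrete P1' PM') ob cmor
    concrete_functor1 concrete_functorM.

End ConcreteFunctor.

(* A left module over an algebra presented by generators and relations is a
   vector space with one operator for each generator, subject to the relations;
   [x^-1] and [tau^-1] are generators as well. *)

(* Modules over $\mathcal D = k[x,x^{-1}]\langle\partial\rangle$,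
   $\partial x = x \partial + 1$. *)
Record Dmodule (k : fieldType) := DModule {
  Dcar :> lmodType k;
  Dx : Dcar -> Dcar;
  DxV : Dcar -> Dcar;
  Dd : Dcar -> Dcar;
  Dx_linear : linear Dx;
  DxV_linear : linear DxV;
  Dd_linear : linear Dd;
  DxK : cancel Dx DxV;
  DxVK : cancel DxV Dx;
  Dd_x : forall v, Dd (Dx v) = Dx (Dd v) + v
}.

(* Modules over $\Delta = k[z]\langle\tau,\tau^{-1}\rangle$,
   $\tau z = (z - 1) \tau$. *)
Record Deltamodule (k : fieldType) := DeltaModule {
  Deltacar :> lmodType k;
  Deltaz : Deltacar -> Deltacar;
  Deltatau : Deltacar -> Deltacar;
  DeltatauV : Deltacar -> Deltacar;
  Deltaz_linear : linear Deltaz;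
  Deltatau_linear : linear Deltatau;
  DeltatauV_linear : linear DeltatauV;
  DeltatauK : cancel Deltatau DeltatauV;
  DeltatauVK : cancel DeltatauV Deltatau;
  Deltatau_z : forall v,
    Deltatau (Deltaz v) = Deltaz (Deltatau v) - Deltatau v
}.

(* Modules over $k((t))\langle\partial_t\rangle$,
   $\partial_t f = f \partial_t + f'$. *)
Record DKmodule (k : fieldType) := DKModule {
  DKcar :> lmodType (laurent k);
  DKd : DKcar -> DKcar;
  DKdD : forall u v, DKd (u + v) = DKd u + DKd v;
  DKdZ : forall (f : laurent k) v, DKd (f *: v) = f *: DKd v + lderiv f *: v
}.

Definition finite_dim (K : fieldType) (V : lmodType K) : Prop :=
  exists n, inhabited (Vector.axiom n V).

(* Finite dimensional modules over the polynomial ring $k[\pi]$ on which the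
   generator $\pi$ (which is $z - p$) acts nilpotently. *)
Record nilmodule (k : fieldType) := NilModule {
  Ncar :> lmodType k;
  Npi : Ncar -> Ncar;
  Npi_linear : linear Npi;
  Nfin : finite_dim Ncar;
  Nnil : exists n, forall m, iter n Npi m = 0
}.

Section ModuleCategories.
Variable k : fieldType.

Definition Dhom (M N : Dmodule k) (f : M -> N) : Prop :=
  [/\ linear f, forall v, f (Dx v) = Dx (f v) & forall v, f (Dd v) = Dd (f v)].

Definition Deltahom (M N : Deltamodule k) (f : M -> N) : Prop :=
  [/\ linear f, forall v, f (Deltaz v) = Deltaz (f v)
    & forall v, f (Deltatau v) = Deltatau (f v)].

Definition DKhom (M N : DKmodule k) (f : M -> N) : Prop :=
  linear f /\ forall v, f (DKd v) = DKd (f v).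

Definition nilhom (M N : nilmodule k) (f : M -> N) : Prop :=
  linear f /\ forall v, f (Npi v) = Npi (f v).

Fact Dhom1 (M : Dmodule k) : Dhom (@id M).
Proof. by []. Qed.
Fact DhomM (M N P : Dmodule k) (f : N -> P) (g : M -> N) :
  Dhom f -> Dhom g -> Dhom (f \o g).
Proof.
move=> [lf fx fd] [lg gx gd]; split=> [a u v|v|v] /=.
- by rewrite lg lf.
- by rewrite gx fx.
- by rewrite gd fd.
Qed.

Fact Deltahom1 (M : Deltamodule k) : Deltahom (@id M).
Proof. by []. Qed.
Fact DeltahomM (M N P : Deltamodule k) (f : N -> P) (g : M -> N) :
  Deltahom f -> Deltahom g -> Deltahom (f \o g).
Proof.
move=> [lf fx fd] [lg gx gd]; split=> [a u v|v|v] /=.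
- by rewrite lg lf.
- by rewrite gx fx.
- by rewrite gd fd.
Qed.

Fact DKhom1 (M : DKmodule k) : DKhom (@id M).
Proof. by []. Qed.
Fact DKhomM (M N P : DKmodule k) (f : N -> P) (g : M -> N) :
  DKhom f -> DKhom g -> DKhom (f \o g).
Proof.
by move=> [lf fd] [lg gd]; split=> [a u v|v] /=; rewrite ?lg ?lf// gd fd.
Qed.

Fact nilhom1 (M : nilmodule k) : nilhom (@id M).
Proof. by []. Qed.
Fact nilhomM (M N P : nilmodule k) (f : N -> P) (g : M -> N) :
  nilhom f -> nilhom g -> nilhom (f \o g).
Proof.
by move=> [lf fd] [lg gd]; split=> [a u v|v] /=; rewrite ?lg ?lf// gd fd.
Qed.

Definition ModD := concrete Dhom1 DhomM.
Definition ModDelta := concrete Deltahom1 DeltahomM.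
Definition ModDK := concrete DKhom1 DKhomM.
Definition ModFin := concrete nilhom1 nilhomM.

End ModuleCategories.

Section Mellin.
Variable k : fieldType.

Section Obj.
Variable M : Dmodule k.

Let z (v : M) : M := Dx (Dd v).

Fact mellin_z_linear : linear z.
Proof. by move=> a u v; rewrite /z Dd_linear Dx_linear. Qed.
Fact mellin_tau_z v : Dx (z v) = z (Dx v) - Dx v.
Proof.
rewrite /z Dd_x; have := @Dx_linear _ M 1 (Dx (Dd v)) v.
by rewrite !scale1r => ->; rewrite addrK.
Qed.

(* $z := x \partial$, $\tau := x$ *)
Definition mellin_obj : Deltamodule k :=
  DeltaModule mellin_z_linear (@Dx_linear _ M) (@DxV_linear _ M) (@DxK _ M)
    (@DxVK _ M) mellin_tau_z.

End Obj.

Fact mellin_hom (M N : Dmodule k) (f : M -> N) : Dhom f ->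
  @Deltahom k (mellin_obj M) (mellin_obj N) f.
Proof. by move=> [lf fx fd]; split=> // v; rewrite /= fx fd. Qed.

Definition mellin : functor (ModD k) (ModDelta k) :=
  concrete_functor (@Dhom1 k) (@DhomM k) (@Deltahom1 k) (@DeltahomM k)
    mellin_hom (fun _ => frefl _) (fun _ _ _ _ _ _ _ => frefl _).

End Mellin.

Section Forgetful.
Variable k : fieldType.
Local Notation K := (laurent k).

Lemma lmono_unit (m n : int) : m + n = 0 -> lmono k m * lmono k n = 1.
Proof. by rewrite -lmonoD => ->. Qed.

Lemma lmono_linear (V : lmodType K) (m : int) :
  linear (fun v : restr V => (lmono k m *: (v : V) : restr V)).
Proof.
move=> a u v; rewrite scalerDr !restr_scaleE; congr (_ + _).
by rewrite !scalerA mulrC.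
Qed.

Lemma lmono_cancel (V : lmodType K) (m n : int) : n + m = 0 ->
  cancel (fun v : restr V => lmono k m *: (v : V) : restr V)
         (fun v : restr V => lmono k n *: (v : V) : restr V).
Proof. by move=> nm v; rewrite scalerA lmono_unit// scale1r. Qed.

Section Obj.
Variable M : DKmodule k.

Fact DKd_linear :
  linear (fun v : restr M => DKd (v : M) : restr M).
Proof.
move=> a u v; rewrite DKdD restr_scaleE DKdZ lderivZ.
by rewrite -[1]lmono0 lderiv_mono scale0r scaler0 scale0r addr0.
Qed.

Fact forget0_rel (v : restr M) :
  DKd (lmono k 1 *: (v : M)) = lmono k 1 *: DKd (v : M) + v.
Proof. by rewrite DKdZ lderiv_mono subrr scale1r lmono0 scale1r. Qed.

(* $x = t$, $\partial = \partial_t$ *)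
Definition forget0_obj : Dmodule k :=
  @DModule k (restr M) (fun v => lmono k 1 *: (v : M))
    (fun v => lmono k (-1) *: (v : M)) (fun v => DKd (v : M))
    (@lmono_linear M 1) (@lmono_linear M (-1)) DKd_linear
    (@lmono_cancel M 1 (-1) erefl) (@lmono_cancel M (-1) 1 erefl) forget0_rel.

Let dinf (v : restr M) : restr M := - (lmono k 2 *: DKd (v : M)).

Fact dinf_linear : linear dinf.
Proof.
move=> a u v; rewrite /dinf DKd_linear (@lmono_linear M) opprD.
by rewrite -scalerN.
Qed.

Fact forgetoo_rel (v : restr M) :
  dinf (lmono k (-1) *: (v : M)) = lmono k (-1) *: (dinf v : M) + v.
Proof.
rewrite /dinf DKdZ lderiv_mono scalerDr opprD scalerN.
rewrite !scalerA mulrC; congr (_ + _).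
by rewrite -scalerAr -lmonoD mulrN1z scaleN1r scaleNr opprK scale1r.
Qed.

(* With $t = y = x^{-1}$: $x = t^{-1}$ and $\partial_x = - t^2 \partial_t$,
   so that $x \partial_x = - t \partial_t$. *)
Definition forgetoo_obj : Dmodule k :=
  @DModule k (restr M) (fun v => lmono k (-1) *: (v : M))
    (fun v => lmono k 1 *: (v : M)) dinf
    (@lmono_linear M (-1)) (@lmono_linear M 1) dinf_linear
    (@lmono_cancel M (-1) 1 erefl) (@lmono_cancel M 1 (-1) erefl) forgetoo_rel.

End Obj.

Fact DKhom_restr_linear (M N : DKmodule k) (f : M -> N) : DKhom f ->
  linear (f : restr M -> restr N).
Proof. by move=> [lf _] a u v; rewrite !restr_scaleE lf. Qed.

Fact DKhomZ (M N : DKmodule k) (f : M -> N) a v : DKhom f ->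
  f (a *: v) = a *: f v.
Proof.
move=> [lf _]; have f0 : f 0 = 0.
  by have := lf (-1) 0 0; rewrite scaler0 addr0 scaleN1r addNr.
by have := lf a v 0; rewrite f0 !addr0.
Qed.

Fact forget0_hom (M N : DKmodule k) (f : M -> N) : DKhom f ->
  @Dhom k (forget0_obj M) (forget0_obj N) f.
Proof.
move=> hf; split; first exact: DKhom_restr_linear.
- by move=> v; rewrite /= DKhomZ.
- exact: hf.2.
Qed.

Fact forgetoo_hom (M N : DKmodule k) (f : M -> N) : DKhom f ->
  @Dhom k (forgetoo_obj M) (forgetoo_obj N) f.
Proof.
move=> hf; split; first exact: DKhom_restr_linear.
- by move=> v; rewrite /= DKhomZ.
- by move=> v; rewrite /= -[X in f X = _]scaleNr DKhomZ// hf.2 scaleNr.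
Qed.

Definition forget0 : functor (ModDK k) (ModD k) :=
  concrete_functor (@DKhom1 k) (@DKhomM k) (@Dhom1 k) (@DhomM k)
    forget0_hom (fun _ => frefl _) (fun _ _ _ _ _ _ _ => frefl _).

Definition forgetoo : functor (ModDK k) (ModD k) :=
  concrete_functor (@DKhom1 k) (@DKhomM k) (@Dhom1 k) (@DhomM k)
    forgetoo_hom (fun _ => frefl _) (fun _ _ _ _ _ _ _ => frefl _).

End Forgetful.

Section Lattices.
Variables (k : fieldType) (V : lmodType (laurent k)).

(* the $k[[t]]$-submodule generated by [s] *)
Definition pspan (s : seq V) : set V :=
  [set v | exists2 c : nat -> laurent k, (forall i, is_pseries (c i)) &
     v = \sum_(i < size s) c i *: s`_i].

Definition lattice (L : set V) : Prop :=
  exists s : seq V, L = pspan s /\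
    forall v, exists c : nat -> laurent k, v = \sum_(i < size s) c i *: s`_i.

(* For $t = \tau^{\pm 1}$; the finitely generated submodules are taken over
   $k[[t]]$, so that this gives the lattice topology of [V]. *)
Definition open_subspace (U : set V) : Prop :=
  [/\ U 0, forall (a : k) u v, U u -> U v -> U ((a%:A : laurent k) *: u + v) &
    forall s : seq V, exists n : nat,
      forall v, pspan s v -> U (lmono k n%:Z *: v)].

Definition adic_open (O : set V) : Prop :=
  forall v, O v -> exists2 U, open_subspace U & forall u, U u -> O (v + u).

Fact adic_openT : adic_open setT.
Proof. by move=> v _; exists setT => //; split=> // s; exists 0%N. Qed.

Fact pspan_monoZ s (n : nat) v : pspan s v -> pspan s (lmono k n%:Z *: v).
Proof.
move=> [c cP ->]; exists (fun i => lmono k n%:Z * c i) => [i j j0|].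
  by rewrite lcoef_monoM cP//; lia.
by rewrite scaler_sumr; apply: eq_bigr => i _; rewrite scalerA.
Qed.

Fact adic_openI : setI_closed adic_open.
Proof.
move=> A B oA oB v [/oA[U [U0 UD Us] UA] /oB[W [W0 WD Ws] WB]].
exists (U `&` W); last by move=> u [/UA ? /WB].
split=> // [a u w [Uu Wu] [Uw Ww]|s]; first by split; [exact: UD|exact: WD].
have [[n Un] [m Wm]] := (Us s, Ws s); exists (n + m)%N => v' sv'.
rewrite PoszD; split.
  by rewrite lmonoD -scalerA; apply: Un; exact: pspan_monoZ.
by rewrite addrC lmonoD -scalerA; apply: Wm; exact: pspan_monoZ.
Qed.

Fact adic_open_bigU (I : Type) (f : I -> set V) :
  (forall i, adic_open (f i)) -> adic_open (\bigcup_i f i).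
Proof.
move=> fo v [i _ /fo[U oU Uf]]; exists U => // u /Uf fu; by exists i.
Qed.

Definition adic : Type := V.
HB.instance Definition _ := Choice.on adic.
HB.instance Definition _ :=
  isOpenTopological.Build adic adic_openT adic_openI adic_open_bigU.

End Lattices.

Definition homeomorphism (S T : topologicalType) (f : S -> T) : Prop :=
  exists g : T -> S, [/\ cancel f g, cancel g f, continuous f & continuous g].

Section Hol.
Variable k : fieldType.

(* $t \partial_t$ *)
Definition DKtheta (F : DKmodule k) (v : F) : F := lmono k 1 *: DKd v.

Definition reg_sing (q : k) (F : DKmodule k) : Prop :=
  finite_dim F /\
  exists L : set F, [/\ lattice L, forall v, L v -> L (DKtheta v) &
    exists n : nat, forall v, L v -> exists2 w, L w &
      iter n (fun u => DKtheta u - (q%:A : laurent k) *: u) v =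
      lmono k 1 *: w].

Definition HolReg (q : k) : category :=
  @full_subcat (ModDK k) (reg_sing q).

Definition HolReg_incl (q : k) : functor (HolReg q) (ModDK k) :=
  @full_incl (ModDK k) (reg_sing q).

End Hol.

Section KTensor.
Variables (k : fieldType) (N : lmodType k).
Local Notation K := (laurent k).

(* $k((t)) \otimes_k N$ *)
Definition ktensor : Type := tensor K N.
HB.instance Definition _ := GRing.Zmodule.copy ktensor (tensor K N).

Lemma bilin_map (f : K -> K) (g : N -> N) : linear f -> linear g ->
  bilin (fun u w => tpure (f u) (g w) : tensor K N).
Proof.
have [bl br] := @tpure_bilin k K N.
by move=> lf lg; split=> [w a u v|u a w w'] /=; rewrite ?lf ?lg ?bl ?br.
Qed.

Let scale (f : K) (x : ktensor) : ktensor :=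
  tlift (fun g m => tpure (f * g) m : tensor K N) x.

Lemma lmul_linear (f : K) : linear (fun g : K => f * g).
Proof. by move=> a u v; rewrite mulrDr scalerAr. Qed.

Fact scale_bilin (f : K) :
  bilin (fun g m => tpure (f * g) m : tensor K N).
Proof. by apply: (@bilin_map (fun g => f * g) id); first exact: lmul_linear. Qed.

Fact ktensor_scale_linear f : linear (scale f : tensor K N -> tensor K N).
Proof. exact: tlift_linear (scale_bilin f). Qed.

Fact ktensor_scale_pure f g m : scale f (tpure g m) = tpure (f * g) m.
Proof. exact: tlift_pure (scale_bilin f). Qed.

Fact ktensor_scaleA f g x : scale f (scale g x) = scale (f * g) x.
Proof.
apply: (@tensor_lin_ext k K N (tensor K N) (fun x => scale f (scale g x))).
- by move=> a u v; rewrite !ktensor_scale_linear.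
- exact: ktensor_scale_linear.
- by move=> u w; rewrite !ktensor_scale_pure mulrA.
Qed.
Fact ktensor_scale1 : left_id 1 scale.
Proof.
apply: (@tensor_lin_ext k K N (tensor K N) (scale 1) id) => //.
- exact: ktensor_scale_linear.
- by move=> u w; rewrite !ktensor_scale_pure mul1r.
Qed.
Fact ktensor_scaleDr : right_distributive scale +%R.
Proof.
move=> f x y; have := @ktensor_scale_linear f 1 x y.
by rewrite !scale1r.
Qed.
Fact ktensor_scaleDl x : {morph scale^~ x : f g / f + g}.
Proof.
move=> f g /=; move: x.
apply: (@tensor_lin_ext k K N (tensor K N) (scale (f + g))
  (fun x => scale f x + scale g x)).
- exact: ktensor_scale_linear.
- move=> a u v; rewrite !ktensor_scale_linear scalerDr.
  by rewrite addrACA.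
- move=> u w; rewrite !ktensor_scale_pure mulrDl.
  by have := (@tpure_bilin k K N).1 w 1 (f * u) (g * u); rewrite !scale1r.
Qed.
(* $f (g \otimes m) = f g \otimes m$ *)
HB.instance Definition _ := GRing.Zmodule_isLmodule.Build K ktensor
  ktensor_scaleA ktensor_scale1 ktensor_scaleDr ktensor_scaleDl.

Definition kpure (f : K) (m : N) : ktensor := tpure f m.

Lemma kscale_pure (f g : K) m : f *: kpure g m = kpure (f * g) m.
Proof. exact: ktensor_scale_pure. Qed.

Lemma kpureDl (f g : K) m : kpure (f + g) m = kpure f m + kpure g m.
Proof. by have := (@tpure_bilin k K N).1 m 1 f g; rewrite !scale1r. Qed.

Lemma restr_tensorE (a : k) (x : restr ktensor) :
  a *: x = (a *: (x : tensor K N) : tensor K N).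
Proof.
move: x; apply: (@tensor_lin_ext k K N (tensor K N)
  (fun x => (a *: (x : restr ktensor) : restr ktensor)) (fun x => a *: x)).
- by move=> b u v; rewrite restr_scaleE [LHS]ktensor_scale_linear.
- by move=> b u v; rewrite scalerDr !scalerA mulrC.
- move=> u w; rewrite restr_scaleE [LHS]ktensor_scale_pure.
  by rewrite -scalerAl mul1r (bilinZl _ _ _ (@tpure_bilin k K N)).
Qed.

End KTensor.

Section Iota.
Variables (k : fieldType) (p : k).
Local Notation K := (laurent k).

(* $z (\sum_n a_n t^n \otimes m)
     = \sum_n c_n a_n t^n \otimes m + \sum_n a_n t^n \otimes \pi m$ *)
Definition iota_z (c : int -> k) (N : nilmodule k) (x : ktensor N) : ktensor N :=
  tlift (fun f m => kpure (lhad c f) m + kpure f (Npi m) : tensor K N) x.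

Lemma lhad_linear (c : int -> k) : linear (lhad c).
Proof.
by move=> a f g; apply: laurentP => n; rewrite /= mulrDr mulrCA.
Qed.

Section Obj.
Variable N : nilmodule k.

Lemma iota_z_bilin (c : int -> k) :
  bilin (fun f (m : N) => kpure (lhad c f) m + kpure f (Npi m) : tensor K N).
Proof.
have lidK : linear (@id K) by [].
have lidN : linear (@id N) by [].
have [b1l b1r] := bilin_map (@lhad_linear c) lidN.
have [b2l b2r] := bilin_map lidK (@Npi_linear _ N).
split=> [w a u v|u a w w'] /=; rewrite scalerDr addrACA; congr (_ + _).
- exact: b1l.
- exact: b2l.
- exact: b1r.
- exact: b2r.
Qed.

Lemma iota_z_pure c f (m : N) :
  iota_z c (kpure f m) = kpure (lhad c f) m + kpure f (Npi m).
Proof. exact: tlift_pure (iota_z_bilin c). Qed.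

Fact iota_z_tlinear c :
  linear (iota_z c (N := N) : tensor K N -> tensor K N).
Proof. exact: tlift_linear (iota_z_bilin c). Qed.

Fact iota_z_linear c :
  linear (iota_z c (N := N) : restr (ktensor N) -> restr (ktensor N)).
Proof. by move=> a u v; rewrite !restr_tensorE iota_z_tlinear. Qed.

Fact iota_rel (c : int -> k) (j : int) (x : restr (ktensor N)) :
    (forall n, c (n + j) = c n + 1) ->
  lmono k j *: (iota_z c x : ktensor N) =
  iota_z c (lmono k j *: (x : ktensor N)) - lmono k j *: (x : ktensor N).
Proof.
move=> cj; move: x; apply: (@tensor_lin_ext k K N (tensor K N)
  (fun x => lmono k j *: (iota_z c x : ktensor N) : ktensor N)
  (fun x => iota_z c (lmono k j *: (x : ktensor N))
            - lmono k j *: (x : ktensor N) : ktensor N)).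
- by move=> a u v; rewrite iota_z_tlinear [LHS]ktensor_scale_linear.
- move=> a u v; rewrite [X in iota_z c X]ktensor_scale_linear iota_z_tlinear.
  rewrite [X in _ - X]ktensor_scale_linear scalerBr opprD.
  by rewrite addrACA.
- move=> f m; rewrite -/(kpure f m) iota_z_pure scalerDr !kscale_pure.
  rewrite iota_z_pure addrAC; congr (_ + _).
  rewrite (_ : lhad c (lmono k j * f) =
               lmono k j * lhad c f + lmono k j * f); last first.
    apply: laurentP => n; rewrite lcoefD lcoef_had !lcoef_monoM lcoef_had.
    by rewrite -{1}[n](subrK j) cj mulrDl mul1r.
  by rewrite kpureDl addrK.
Qed.

Fact iota_right_rel (n : int) :
  (p + (n + 1)%:~R) = (p + n%:~R) + 1 :> k.
Proof. by rewrite intrD addrA. Qed.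

(* $\tau = t$ acts by multiplication on $k((\tau)) \otimes N$ *)
Definition iota_right_obj : Deltamodule k :=
  @DeltaModule k (restr (ktensor N)) (@iota_z (fun n => p + n%:~R) N)
    (fun x => lmono k 1 *: (x : ktensor N))
    (fun x => lmono k (-1) *: (x : ktensor N))
    (iota_z_linear _) (@lmono_linear k (ktensor N) 1)
    (@lmono_linear k (ktensor N) (-1))
    (@lmono_cancel k (ktensor N) 1 (-1) erefl)
    (@lmono_cancel k (ktensor N) (-1) 1 erefl)
    (fun x => iota_rel x iota_right_rel).

Fact iota_left_rel (n : int) :
  (p + (- (n - 1))%:~R) = (p + (- n)%:~R) + 1 :> k.
Proof. by rewrite opprD opprK intrD addrA. Qed.

(* $\tau^{-1} = t$: the coefficient of $t^n$ is that of $\tau^{-n}$, on which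
   the formula prescribes the factor $p - n$. *)
Definition iota_left_obj : Deltamodule k :=
  @DeltaModule k (restr (ktensor N)) (@iota_z (fun n => p + (- n)%:~R) N)
    (fun x => lmono k (-1) *: (x : ktensor N))
    (fun x => lmono k 1 *: (x : ktensor N))
    (iota_z_linear _) (@lmono_linear k (ktensor N) (-1))
    (@lmono_linear k (ktensor N) 1)
    (@lmono_cancel k (ktensor N) (-1) 1 erefl)
    (@lmono_cancel k (ktensor N) 1 (-1) erefl)
    (fun x => iota_rel x iota_left_rel).

End Obj.

Definition iota_map (M N : nilmodule k) (u : M -> N) (x : ktensor M) :
    ktensor N :=
  tlift (fun f m => kpure f (u m) : tensor K N) x.

Lemma iota_map_bilin (M N : nilmodule k) (u : M -> N) : linear u ->
  bilin (fun f m => kpure f (u m) : tensor K N).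
Proof.
have [bl br] := @tpure_bilin k K N.
by move=> lu; split=> [w|f a w w']; [exact: bl | rewrite lu; exact: br].
Qed.

Lemma iota_map_pure (M N : nilmodule k) (u : M -> N) f m : linear u ->
  iota_map u (kpure f m) = kpure f (u m).
Proof. by move=> lu; exact: tlift_pure (iota_map_bilin lu). Qed.

Fact iota_map_tlinear (M N : nilmodule k) (u : M -> N) : linear u ->
  linear (iota_map u : tensor K M -> tensor K N).
Proof. by move=> lu; exact: tlift_linear (iota_map_bilin lu). Qed.

Fact iota_map_linear (M N : nilmodule k) (u : M -> N) : linear u ->
  linear (iota_map u : restr (ktensor M) -> restr (ktensor N)).
Proof. by move=> lu a x y; rewrite !restr_tensorE iota_map_tlinear. Qed.

Fact iota_map_scale (M N : nilmodule k) (u : M -> N) (f : K) x : linear u ->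
  iota_map u (f *: x) = f *: iota_map u x.
Proof.
move=> lu; move: x; apply: (@tensor_lin_ext k K M (tensor K N)
  (fun x => iota_map u (f *: (x : ktensor M)) : ktensor N)
  (fun x => f *: (iota_map u x) : ktensor N)).
- by move=> a v w; rewrite [X in iota_map u X]ktensor_scale_linear iota_map_tlinear.
- by move=> a v w; rewrite iota_map_tlinear// [LHS]ktensor_scale_linear.
- by move=> g m; rewrite -/(kpure g m) kscale_pure !iota_map_pure// kscale_pure.
Qed.

Fact iota_map_z c (M N : nilmodule k) (u : M -> N) x : nilhom u ->
  iota_map u (iota_z c x) = iota_z c (iota_map u x).
Proof.
move=> [lu upi]; move: x; apply: (@tensor_lin_ext k K M (tensor K N)
  (fun x => iota_map u (iota_z c x)) (fun x => iota_z c (iota_map u x))).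
- by move=> a v w; rewrite iota_z_tlinear iota_map_tlinear.
- by move=> a v w; rewrite iota_map_tlinear// iota_z_tlinear.
- move=> g m; rewrite -/(kpure g m) iota_z_pure iota_map_pure// iota_z_pure.
  have := @iota_map_tlinear _ _ _ lu 1 (kpure (lhad c g) m) (kpure g (Npi m)).
  by rewrite !scale1r => ->; rewrite !iota_map_pure// upi.
Qed.

Fact iota_right_hom (M N : nilmodule k) (u : M -> N) : nilhom u ->
  @Deltahom k (iota_right_obj M) (iota_right_obj N) (iota_map u).
Proof.
move=> hu; have lu := hu.1; split; first exact: iota_map_linear.
- by move=> x; exact: iota_map_z.
- by move=> x; exact: iota_map_scale.
Qed.

Fact iota_left_hom (M N : nilmodule k) (u : M -> N) : nilhom u ->
  @Deltahom k (iota_left_obj M) (iota_left_obj N) (iota_map u).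
Proof.
move=> hu; have lu := hu.1; split; first exact: iota_map_linear.
- by move=> x; exact: iota_map_z.
- by move=> x; exact: iota_map_scale.
Qed.

Fact iota_map1 (M : nilmodule k) : iota_map (@id M) =1 id.
Proof.
apply: (@tensor_lin_ext k K M (tensor K M) (iota_map (@id M)) id) => //.
- exact: iota_map_tlinear.
- by move=> f m; rewrite -/(kpure f m) iota_map_pure.
Qed.

Fact iota_mapM (M N P : nilmodule k) (u : N -> P) (v : M -> N) :
  nilhom u -> nilhom v -> iota_map (u \o v) =1 iota_map u \o iota_map v.
Proof.
move=> [lu _] [lv _]; have luv : linear (u \o v).
  by move=> a x y /=; rewrite lv lu.
apply: (@tensor_lin_ext k K M (tensor K P) (iota_map (u \o v))
  (iota_map u \o iota_map v)).
- exact: iota_map_tlinear.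
- by move=> a x y /=; rewrite iota_map_tlinear// iota_map_tlinear.
- by move=> f m; rewrite -/(kpure f m) /= !iota_map_pure.
Qed.

Definition iota_right : functor (ModFin k) (ModDelta k) :=
  concrete_functor (@nilhom1 k) (@nilhomM k) (@Deltahom1 k) (@DeltahomM k)
    iota_right_hom iota_map1 iota_mapM.

Definition iota_left : functor (ModFin k) (ModDelta k) :=
  concrete_functor (@nilhom1 k) (@nilhomM k) (@Deltahom1 k) (@DeltahomM k)
    iota_left_hom iota_map1 iota_mapM.

End Iota.

Section LocalMellin.
Variables (k : fieldType) (p : k).

Definition mellin_forget0 : functor (HolReg p) (ModDelta k) :=
  functor_comp (mellin k) (functor_comp (forget0 k) (HolReg_incl p)).

Definition mellin_forgetoo : functor (HolReg (- p)) (ModDelta k) :=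
  functor_comp (mellin k) (functor_comp (forgetoo k) (HolReg_incl (- p))).

(* The underlying spaces of [mellin_forget0 F] and [iota_right p N] are those
   of [F] and $k((t)) \otimes N$, and carry the $t$-adic topologies of these
   two $k((t))$-modules; here $t = \tau$. *)
Definition is_mellin0 (E : functor (HolReg p) (ModFin k)) : Prop :=
  exists eta : nat_iso mellin_forget0 (functor_comp (iota_right p) E),
    forall F : HolReg p,
      homeomorphism (sval (eta F) : adic (DKcar (sval F)) ->
                                    adic (ktensor (Ncar (E F)))).

(* likewise with $t = \tau^{-1}$ *)
Definition is_mellinoo (E : functor (HolReg (- p)) (ModFin k)) : Prop :=
  exists eta : nat_iso mellin_forgetoo (functor_comp (iota_left p) E),
    forall F : HolReg (- p),
      homeomorphism (sval (eta F) : adic (DKcar (sval F)) ->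
                                    adic (ktensor (Ncar (E F)))).

End LocalMellin.

(* Main.v *)
Require Import Defs.
From mathcomp Require Import all_boot all_order all_algebra.
From mathcomp Require Import boolp classical_sets reals topology_structure.
From mathcomp Require Import complex.
From HB Require Import structures.
From mathcomp Require Import zify.

Set Implicit Arguments.
Unset Strict Implicit.
Unset Printing Implicit Defensive.

Import Order.TTheory GRing.Theory Num.Theory.
Local Open Scope ring_scope.

(** Write $\theta = t\partial_t$, where $t$ is the coordinate $x$ at $0$ or
    $x^{-1}$ at infinity, so that $z = x\partial_x$ is $e\theta$ with
    $e = \pm 1$, and let $N(F)$ be the generalized eigenspace of $z$ on $F$ for
    the eigenvalue $p$, with $\pi = z - p$ acting on it.  The functor
    $F \mapsto N(F)$ is the equivalence, its quasi-inverse sends $N$ to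
    $k((t)) \otimes N$ with $\partial_t = e\,t^{-1}z$, and the comparison
    isomorphism is the inverse of the multiplication map
    $k((t)) \otimes N(F) \to F$, $f \otimes v \mapsto fv$.  By the Leibniz
    rule [DKz_scale] the latter is $z$-linear for the action of $z$ that
    defines $\iota_{p!}$.

    The analytic content is that this map is bijective when $F$ is regular
    singular with leading term $q = ep$.  Let $L$ be a lattice on which
    $T = z - p$ is nilpotent modulo $t$; it is free over $k[[t]]$
    ([lattice_basis]).  On $t^aL/t^{a+1}L$ the operator $T$ has the single
    eigenvalue $ea$, which vanishes only for $a = 0$ in characteristic $0$.
    Hence a vector killed by a power of $T$ lies in $L$, and is zero if it lies
    in $tL$ ([geneigen_lattice], [geneigen_small]); conversely, since $T$ is
    invertible on the quotients with $a > 0$, each class in $L/tL$ lifts to such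
    a vector by successive approximation ([geneigen_lift]).  So $N(F)$ maps
    isomorphically onto $L/tL$, and a $k$-basis of it is a $k((t))$-basis of $F$
    ([geneigen_basis]).

    The comparison isomorphism is $k((t))$-linear, hence a homeomorphism
    ([linear_homeomorphism]).  For uniqueness, $N$ is recovered from
    $k((t)) \otimes N$ as the generalized eigenspace of $z$ for $p$, which is
    $1 \otimes N$ ([ext_geneigen]).  A natural isomorphism between the extensions
    of two functors therefore restricts to one between the functors themselves
    ([deg0_nat_iso]). *)

(** * Linear maps and operators differing by a scalar *)

(** One carrier often has two scalar fields here, $k$ and $k((t))$, so
    linearity is a hypothesis on a bare function and its consequences are
    restated in that form. *)
Section LinearMap.
Variables (R : nzRingType) (U V : lmodType R) (f : U -> V).
Hypothesis lf : linear f.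

Let f' := HB.pack_for {linear U -> V} f
  (GRing.isLinear.Build _ _ _ _ _ lf).

Lemma linear_fun0 : f 0 = 0. Proof. exact: (raddf0 f'). Qed.
Lemma linear_funD u v : f (u + v) = f u + f v.
Proof. exact: (raddfD f'). Qed.
Lemma linear_funB u v : f (u - v) = f u - f v.
Proof. exact: (raddfB f'). Qed.
Lemma linear_funZ a u : f (a *: u) = a *: f u.
Proof. exact: (linearZ_LR f'). Qed.
Lemma linear_fun_sum (I : Type) (r : seq I) (E : I -> U) :
  f (\sum_(i <- r) E i) = \sum_(i <- r) f (E i).
Proof. exact: (raddf_sum f'). Qed.

End LinearMap.

Lemma linear_iter (R : nzRingType) (U : lmodType R) (f : U -> U) n :
  linear f -> linear (iter n f).
Proof. by move=> lf; elim: n => // n IHn a u v; rewrite !iterS IHn lf. Qed.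

Section Coprime.
Variables (k : fieldType) (U : lmodType k) (T : U -> U) (c : k).
Hypotheses (T_linear : linear T) (c0 : c != 0).
Variable W : set U.
Hypothesis W_lin : forall a u v, W u -> W v -> W (a *: u + v).
Hypothesis W_T : forall u, W u -> W (T u).

Let S u := T u - c *: u.

Let W_0 u : W u -> W 0.
Proof. by move=> Wu; rewrite -(addNr u) -scaleN1r; apply: W_lin. Qed.

Let W_Z a u : W u -> W (a *: u).
Proof. by move=> Wu; rewrite -[_ *: _]addr0; apply: W_lin; last exact: W_0 Wu. Qed.

Let W_S u : W u -> W (S u).
Proof. by move=> Wu; rewrite /S addrC -scaleNr; apply: W_lin; last exact: W_T. Qed.

Let TS u : T (S u) = S (T u).
Proof. by rewrite /S linear_funB// linear_funZ. Qed.

Let T_iterS n u : T (iter n S u) = iter n S (T u).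
Proof. by elim: n => //= n <-; rewrite TS. Qed.

Let S_iterT n u : S (iter n T u) = iter n T (S u).
Proof. by elim: n => //= n <-; rewrite TS. Qed.

(** The polynomials $X^m$ and $(X-c)^n$ are coprime.  The induction on $m+n$
    replaces the Bezout relation: once $Tv$ and $(T-c)v$ are in $W$, so is
    their difference $cv$. *)
Lemma coprime_iter m n v :
  W (iter m T v) -> W (iter n (fun u => T u - c *: u) v) -> W v.
Proof.
elim: m n v => [//|m IHm] n v; elim: n v => [//|n IHn] v.
rewrite -/S => Wm Wn; rewrite -[v]scale1r -(mulVf c0) -scalerA.
have -> : c *: v = (-1) *: S v + T v.
  by rewrite scaleN1r /S opprB subrK.
have WT : W (T v).
  apply: (IHm n.+1); first by rewrite -iterSr.
  by rewrite -/S -T_iterS; apply: W_T.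
have WS : W (S v).
  apply: IHn; last by rewrite -iterSr.
  by rewrite -S_iterT; apply: W_S.
by apply: W_Z; exact: W_lin.
Qed.

Variable A : set U.
Hypothesis A0 : A 0.
Hypothesis A_lin : forall a u v, A u -> A v -> A (a *: u + v).
Hypothesis A_T : forall u, A u -> A (T u).

(** The induction on $n$ reduces the equation $Tu \equiv r$ to the one with
    right-hand side $(T-c)r$. *)
Lemma coprime_solve1 n r : A r -> W (iter n (fun u => T u - c *: u) r) ->
  exists2 u, A u & W (T u - r).
Proof.
elim: n r => [|n IHn] r Ar.
  move=> Wr; exists 0 => //; rewrite linear_fun0// sub0r -scaleN1r.
  exact: W_Z.
rewrite iterSr => /IHn[|u Au Wu].
  by rewrite addrC -scaleNr; apply: A_lin; last exact: A_T.
(* $Tu \equiv Tr - cr$ gives $r \equiv T(c^{-1}(r-u))$. *)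
exists (c^-1 *: ((-1) *: u + r)).
  by rewrite -[_ *: (_ + _)]addr0; apply: A_lin => //; exact: A_lin.
rewrite (_ : _ - r = (- c^-1) *: (T u - S r)); first exact: W_Z.
rewrite linear_funZ// linear_funD// linear_funZ// /S scaleN1r.
rewrite scaleNr -scalerN opprB -{2}[r]scale1r -(mulVf c0) -scalerA -scalerBr.
by rewrite [- T u + _]addrC addrAC.
Qed.

(** On $A/W$ the operator $T - c$ is nilpotent and $c \ne 0$, so $T$ and all
    its powers are onto. *)
Lemma coprime_solve m n r :
    (forall u, A u -> W (iter n (fun u => T u - c *: u) u)) -> A r ->
  exists2 u, A u & W (iter m T u - r).
Proof.
move=> An Ar; elim: m => [|m [u Au Wu]].
  by exists r => //=; rewrite subrr; exact: W_0 (An _ Ar).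
have [u' Au' Wu'] := coprime_solve1 Au (An _ Au); exists u' => //.
rewrite iterSr -[T u'](subrK u) linear_funD//; last exact: linear_iter.
rewrite -addrA -[iter m T _]scale1r; apply: W_lin => //.
by elim: (m) => //= j; apply: W_T.
Qed.

End Coprime.

(** * Laurent series and their orders *)

Section LaurentOrder.
Variable k : fieldType.
Implicit Types (f g : laurent k) (a b : int).

Lemma vanish_le f a b : b <= a -> vanish_below f a -> vanish_below f b.
Proof. by move=> ba fa i ib; apply: fa; exact: lt_le_trans ba. Qed.

Lemma vanishD f g a : vanish_below f a -> vanish_below g a ->
  vanish_below (f + g) a.
Proof. by move=> fa ga i ia; rewrite lcoefD fa// ga// addr0. Qed.

Lemma vanishM f g a b : vanish_below f a -> vanish_below g b ->
  vanish_below (f * g) (a + b).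
Proof. exact: lmul_vanish. Qed.

Lemma vanish_sum (I : Type) (r : seq I) (F : I -> laurent k) a :
  (forall i, vanish_below (F i) a) -> vanish_below (\sum_(i <- r) F i) a.
Proof.
move=> Fa; elim/big_rec: _ => [//|i f _ fa]; exact: vanishD.
Qed.

Lemma vanish_mono a : vanish_below (lmono k a) a.
Proof. by move=> i ia /=; rewrite lt_eqF. Qed.

Lemma algE (x : k) i : (x%:A : laurent k) i = x * (i == 0)%:R.
Proof. by []. Qed.

Lemma vanish_alg (x : k) : vanish_below (x%:A : laurent k) 0.
Proof. by move=> i i0; rewrite algE lt_eqF// mulr0. Qed.

Lemma vanish_all f : (forall a, vanish_below f a) -> f = 0.
Proof. by move=> fa; apply: laurentP => i; apply: (fa (i + 1)); lia. Qed.

Lemma lcoefM_lead f g a b : vanish_below f a -> vanish_below g b ->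
  (f * g) (a + b) = f a * g b.
Proof.
move=> fa gb; rewrite lcoefM (@lmul_coefE _ f g _ a b 1)//; last by lia.
by rewrite big_ord1 /=; congr (f _ * g _); lia.
Qed.

Lemma valuation f : f != 0 -> exists2 a, vanish_below f a & f a != 0.
Proof.
move=> f0; have [a fa] := lcoef_bounded f.
have ex : exists j : nat, f (a + j%:Z) != 0.
  apply: contrapT => /forallNP fN; move/eqP: f0; apply; apply: laurentP => i.
  case: (ltP i a) => [/fa//|ai]; apply/eqP/negPn/negP => fi.
  by apply: (fN (absz (i - a)%R)); rewrite (_ : a + _ = i)//; lia.
case: (ex_minnP ex) => j fj minj; exists (a + j%:Z) => // i ij.
case: (ltP i a) => [/fa//|ai]; apply/eqP/negPn/negP => fi.
have := minj (absz (i - a)%R); rewrite (_ : a + _ = i); last lia.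
by move=> /(_ fi); lia.
Qed.

(** The order of $f^{-1}$ is forced by the product of the leading
    coefficients, which is the constant coefficient of $1$ only if the orders
    cancel. *)
Lemma vanishV f a : vanish_below f a -> f a != 0 -> vanish_below f^-1 (- a).
Proof.
move=> fa fa0; have f0 : f != 0 by apply: contraNneq fa0 => ->; rewrite lcoef0.
have [b gb gb0] := valuation (invr_neq0 f0).
suff -> : - a = b by [].
have := lcoefM_lead fa gb; rewrite divff// -lmono0 /=.
case: eqP => [|_ /esym/eqP]; first by lia.
by rewrite mulf_eq0 (negPf fa0) (negPf gb0).
Qed.

Lemma row_vanish d (x : 'rV[laurent k]_d) :
  exists N : nat, forall i, vanish_below (x 0 i) (- N%:Z).
Proof.
have /choice[N xN] i : exists N : nat, vanish_below (x 0 i) (- N%:Z).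
  have [N xN] := lcoef_bounded (x 0 i); exists (absz N).
  by apply: vanish_le xN; lia.
exists (\sum_i N i)%N => i; apply: vanish_le (xN i).
by rewrite lerN2 (bigD1 i)//= PoszD lerDl.
Qed.

Lemma vanish_sub_const f :
  vanish_below f 0 -> vanish_below (f - (f 0)%:A) 1.
Proof.
move=> f0 i i1; rewrite lcoefD lcoefN algE.
have [->|i0] := eqVneq i 0; first by rewrite mulr1 subrr.
by rewrite mulr0 subr0; apply: f0; lia.
Qed.

End LaurentOrder.

(** * The filtration of a vector space over Laurent series by a lattice *)

Definition comb (R : nzRingType) (V : lmodType R) d (b : 'I_d -> V)
  (x : 'rV[R]_d) : V := \sum_i x 0 i *: b i.

Lemma comb_linear (R : nzRingType) (V : lmodType R) d (b : 'I_d -> V) :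
  linear (comb b).
Proof.
move=> a x y; rewrite /comb scaler_sumr -big_split.
by apply: eq_bigr => i _; rewrite !mxE scalerDl scalerA.
Qed.

Lemma comb_delta (R : nzRingType) (V : lmodType R) d (b : 'I_d -> V) i :
  comb b (delta_mx 0 i) = b i.
Proof.
rewrite /comb (bigD1 i)//= big1 => [|j ji]; rewrite !mxE ?eqxx ?scale1r ?addr0//.
by rewrite (negPf ji) scale0r.
Qed.

Section Filtration.
Variables (k : fieldType) (V : lmodType (laurent k)) (d : nat) (b : 'I_d -> V).
Local Notation K := (laurent k).
Implicit Types (v : V) (a c : int).

(** For the lattice $L = \sum_i k[[t]] b_i$ this is $t^a L$. *)
Definition Fil a : set V := fun v =>
  exists2 x : 'rV[K]_d, (forall i, vanish_below (x 0 i) a) & v = comb b x.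

Lemma Fil_0 a : Fil a 0.
Proof.
exists 0; last by rewrite (linear_fun0 (comb_linear b)).
by move=> i j _; rewrite mxE.
Qed.

Lemma Fil_lin a (f : K) u v : vanish_below f 0 -> Fil a u -> Fil a v ->
  Fil a (f *: u + v).
Proof.
move=> f0 [x xa ->] [y ya ->]; exists (f *: x + y); last by rewrite comb_linear.
move=> i; rewrite !mxE; apply: vanishD => //.
by rewrite -[a]add0r; apply: vanishM.
Qed.

Lemma Fil_D a u v : Fil a u -> Fil a v -> Fil a (u + v).
Proof.
by move=> ua va; rewrite -[u]scale1r; apply: Fil_lin => //; exact: vanish_mono.
Qed.

Lemma Fil_N a u : Fil a u -> Fil a (- u).
Proof.
move=> [x xa ->]; exists (- x) => [i j ja|]; first by rewrite mxE lcoefN xa ?oppr0.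
by rewrite -[- x]scaleN1r (linear_funZ (comb_linear b)) scaleN1r.
Qed.

Lemma Fil_le a c v : c <= a -> Fil a v -> Fil c v.
Proof. by move=> ca [x xa ->]; exists x => // i; exact: vanish_le (xa i). Qed.

Lemma Fil_mono a c v : Fil a v -> Fil (c + a) (lmono k c *: v).
Proof.
move=> [x xa ->]; exists (lmono k c *: x); last first.
  by rewrite (linear_funZ (comb_linear b)).
by move=> i; rewrite mxE; apply: vanishM => //; exact: vanish_mono.
Qed.

Lemma Fil_monoP a v : Fil a v -> exists2 v0, Fil 0 v0 & v = lmono k a *: v0.
Proof.
move=> va; exists (lmono k (- a) *: v); first by rewrite -(addNr a); exact: Fil_mono.
by rewrite scalerA -lmonoD addrN scale1r.
Qed.

Lemma Fil_b i : Fil 0 (b i).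
Proof.
exists (delta_mx 0 i); last by rewrite comb_delta.
move=> j n n0; rewrite mxE; case: (_ && _) => //; exact: vanish_mono.
Qed.

Hypothesis b_bij : bijective (comb b).

Lemma comb_surj v : exists x, v = comb b x.
Proof. by have [g _ gK] := b_bij; exists (g v). Qed.

Lemma FilE a x : Fil a (comb b x) -> forall i, vanish_below (x 0 i) a.
Proof. by move=> [y ya /(bij_inj b_bij) ->]. Qed.

Lemma Fil_ex v : exists n : nat, Fil (- n%:Z) v.
Proof.
have [x ->] := comb_surj v; have [N xN] := row_vanish x.
by exists N, x.
Qed.

Lemma Fil_sum a (I : Type) (r : seq I) (F : I -> V) :
  (forall i, Fil a (F i)) -> Fil a (\sum_(i <- r) F i).
Proof.
by move=> Fa; elim/big_rec: _ => [|i v _ va]; [exact: Fil_0 | exact: Fil_D].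
Qed.

(** Separatedness: $\bigcap_n t^n L = 0$. *)
Lemma Fil_sep v : (forall n : nat, Fil n%:Z v) -> v = 0.
Proof.
have [x ->] := comb_surj v => xF.
suff -> : x = 0 by rewrite (linear_fun0 (comb_linear b)).
apply/rowP => i; rewrite mxE; apply: vanish_all => a.
by apply: (@vanish_le _ _ (absz a)%:Z); [lia | exact: FilE].
Qed.

(** Completeness for the sequences that converge at the rate of successive
    approximation. *)
Lemma Fil_lim (w : nat -> V) : Fil 0 (w 0%N) ->
    (forall j, Fil j.+1%:Z (w j.+1 - w j)) ->
  exists l, forall j, Fil j.+1%:Z (l - w j).
Proof.
have /choice[x wx] j : exists x, w j = comb b x by exact: comb_surj.
move=> w0 wS.
have x0 i : vanish_below (x 0%N 0 i) 0 by apply: FilE; rewrite -wx.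
have xS j i (n : int) : n < j.+1%:Z -> x j.+1 0 i n = x j 0 i n.
  move=> nj; have := wS j; rewrite !wx -(linear_funB (comb_linear b)).
  move=> /FilE/(_ i n nj); rewrite !mxE lcoefD lcoefN.
  by move=> /eqP; rewrite subr_eq0 => /eqP.
have xle j m i (n : int) : n < j.+1%:Z -> x (j + m)%N 0 i n = x j 0 i n.
  move=> nj; elim: m => [|m IHm]; first by rewrite addn0.
  by rewrite addnS xS ?IHm//; lia.
have xneg j i (n : int) : n < 0 -> x j 0 i n = 0.
  by move=> n0; rewrite -(add0n j) xle; [exact: x0 | lia].
(* The coefficient of $t^n$ is final from the $n$-th term of the sequence on. *)
pose X i (n : int) := x (absz n) 0 i n.
have XP i : exists N, vanish_below (X i) N by exists 0 => n; exact: xneg.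
exists (comb b (\row_i Laurent (XP i))) => j.
rewrite wx -(linear_funB (comb_linear b)).
eexists; last by []; move=> i n nj; rewrite !mxE lcoefD lcoefN /= /X.
case: (ltP n 0) => n0; first by rewrite !xneg// subrr.
rewrite -(@xle (absz n) (j - absz n)%N); last by lia.
by rewrite subnKC ?subrr//; lia.
Qed.

Section Lift.
Variable w : 'I_d -> V.
Hypothesis w1 : forall i, Fil 1 (w i - b i).

(** A family congruent to the basis $b$ modulo $t$ is a basis: its matrix
    $M$ in $b$ is congruent to $1$ modulo $t$, so a row killed by $M$ has
    infinite order. *)
Lemma basis_lift : bijective (comb w).
Proof.
have /choice[y yP] i : exists y : 'rV[K]_d,
    (forall j, vanish_below (y 0 j) 1) /\ w i - b i = comb b y.
  by have [y] := w1 i; exists y.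
pose Y : 'M[K]_d := \matrix_(i, j) y i 0 j; pose M := 1%:M + Y.
have wM x : comb w x = comb b (x *m M).
  rewrite mulmxDr mulmx1 (linear_funD (comb_linear b)).
  have -> : x *m Y = \sum_i x 0 i *: y i.
    apply/rowP => j; rewrite !mxE summxE; apply: eq_bigr => i _.
    by rewrite !mxE.
  rewrite (linear_fun_sum (comb_linear b)) {1 2}/comb -big_split.
  apply: eq_bigr => i _; rewrite (linear_funZ (comb_linear b)) -(yP i).2.
  by rewrite /= -scalerDr addrC subrK.
have M_inj (x : 'rV[K]_d) : x *m M = 0 -> x = 0.
  rewrite mulmxDr mulmx1 => /eqP; rewrite addr_eq0 => /eqP xY.
  have [N xN] := Fil_ex (comb b x).
  have xl (l : nat) : Fil (- N%:Z + l%:Z) (comb b x).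
    elim: l => [|l IHl]; first by rewrite addr0.
    exists x => // i; rewrite xY -mulNmx mxE.
    have -> : - N%:Z + l.+1%:Z = - N%:Z + l%:Z + 1 by lia.
    apply: vanish_sum => h; apply: vanishM; last by rewrite mxE; exact: (yP h).1.
    by rewrite mxE => m ml; rewrite lcoefN (FilE IHl)// oppr0.
  apply: (bij_inj b_bij); rewrite (linear_fun0 (comb_linear b)).
  by apply: Fil_sep => j; have := xl (N + j)%N; rewrite PoszD addKr.
have M_unit : M \in unitmx.
  rewrite -row_free_unit -kermx_eq0; apply/eqP/row_matrixP => r; rewrite row0.
  by apply: M_inj; rewrite -row_mul mulmx_ker row0.
have [g bK gK] := b_bij; exists (fun v => g v *m invmx M) => [x|v].
  by rewrite wM bK mulmxK.
by rewrite wM mulmxKV.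
Qed.

(** The constant coefficients of the coordinates of $v$ in $b$ serve, because
    $w$ and $b$ agree modulo $t$. *)
Lemma residue_lift v : Fil 0 v ->
  exists x : 'rV[k]_d, Fil 1 (v - comb (w : 'I_d -> restr V) x).
Proof.
move=> [x x0 ->]; exists (\row_i x 0 i 0).
rewrite /comb -sumrB; apply: Fil_sum => i; rewrite mxE restr_scaleE.
have -> : x 0 i *: b i - ((x 0 i 0)%:A : K) *: w i =
   (x 0 i - (x 0 i 0)%:A) *: b i - ((x 0 i 0)%:A : K) *: (w i - b i).
  by rewrite scalerBl scalerBr opprB addrA subrK.
apply: Fil_D.
  exists ((x 0 i - (x 0 i 0)%:A) *: delta_mx 0 i); last first.
    by rewrite (linear_funZ (comb_linear b)) comb_delta.
  move=> j; rewrite !mxE; case: (_ && _); last by rewrite mulr0.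
  by rewrite mulr1; exact: vanish_sub_const.
apply: Fil_N; rewrite -[_ *: _]addr0; apply: Fil_lin; last exact: Fil_0.
  exact: vanish_alg.
exact: w1.
Qed.

End Lift.

End Filtration.

(** * Generalized eigenvectors of a regular singular operator *)

(** The situation of $T = z - p$ on a regular singular module, with
    $b$ a basis of the lattice and $e = \pm 1$ according to whether $z$ is
    $t\partial_t$ or $-t\partial_t$. *)
Section RegularOperator.
Variables (k : fieldType) (V : lmodType (laurent k)) (d : nat) (b : 'I_d -> V).
Local Notation K := (laurent k).
Hypothesis char0 : [pchar k] =i pred0.
Hypothesis b_bij : bijective (comb b).
Variables (e : k) (T : V -> V) (n : nat).
Hypothesis e0 : e != 0.
Hypothesis T_linear : linear (T : restr V -> restr V).
Hypothesis T_mono : forall j v,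
  T (lmono k j *: v) = lmono k j *: (T v + ((e * j%:~R)%:A : K) *: v).
Hypothesis T_Fil : forall v, Fil b 0 v -> Fil b 0 (T v).
Hypothesis T_nil : forall v, Fil b 0 v -> Fil b 1 (iter n T v).

Let iterT_D m (u v : V) : iter m T (u + v) = iter m T u + iter m T v.
Proof. exact: (linear_funD (linear_iter m T_linear)). Qed.

Let Fil_linR a (x : k) (u v : restr V) : Fil b a u -> Fil b a v ->
  Fil b a (x *: u + v : restr V).
Proof. by apply: Fil_lin; exact: vanish_alg. Qed.

Let T_Fil_gen a v : Fil b a v -> Fil b a (T v).
Proof.
move=> /Fil_monoP[u u0 ->]; rewrite T_mono -{1}[a]addr0; apply: Fil_mono.
rewrite addrC; apply: Fil_lin => //; first exact: vanish_alg.
exact: T_Fil.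
Qed.

(** On $t^a L / t^{a+1} L$ the operator $T$ acts with the single eigenvalue
    $ea$. *)
Let T_shift a (v : restr V) : Fil b a v ->
  Fil b (a + 1) (iter n (fun u : restr V => (T u : restr V) - (e * a%:~R) *: u) v).
Proof.
move=> /Fil_monoP[u u0 ->].
have -> : iter n (fun u : restr V => (T u : restr V) - (e * a%:~R) *: u)
              (lmono k a *: u) = lmono k a *: iter n T u.
  elim: (n) => //= m ->; rewrite T_mono restr_scaleE scalerDr.
  by rewrite !scalerA [_%:A * _]mulrC addrK.
by apply: Fil_mono; exact: T_nil.
Qed.

Let shift_neq0 a : a != 0 -> e * a%:~R != 0 :> k.
Proof.
move=> a0; rewrite mulf_neq0//; have /pcharf0P c0 := char0.
by case: a a0 => m m0; rewrite ?NegzE ?rmorphN ?oppr_eq0 /= ?pmulrn c0.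
Qed.

(** For $a \ne 0$ the eigenvalue $ea$ is nonzero, so a vector of
    $t^a L$ killed by a power of $T$ has zero class in $t^a L/t^{a+1}L$. *)
Let Fil_step m a v : iter m T v = 0 -> a != 0 -> Fil b a v -> Fil b (a + 1) v.
Proof.
move=> vm a0 va.
apply: (@coprime_iter _ (restr V) T _ T_linear (shift_neq0 a0) _ _ _ m n v).
- by move=> x u w; exact: Fil_linR.
- exact: T_Fil_gen.
- by rewrite vm; exact: Fil_0.
- exact: T_shift.
Qed.

(** Climbs the filtration from $t^{-N}L$ up to $L$, where the eigenvalue $0$
    stops the argument. *)
Lemma geneigen_lattice m v : iter m T v = 0 -> Fil b 0 v.
Proof.
move=> vm; have [N] := Fil_ex b_bij v.
elim: N => [//|N IHN /(Fil_step vm)] H; apply: IHN.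
by rewrite (_ : - N%:Z = - N.+1%:Z + 1); [apply: H; lia | lia].
Qed.

(** Beyond $a = 0$ nothing stops the climb any more. *)
Lemma geneigen_small m v : iter m T v = 0 -> Fil b 1 v -> v = 0.
Proof.
move=> vm v1; apply: (Fil_sep b_bij) => j; apply: (@Fil_le _ _ _ _ j.+1%:Z).
  by lia.
elim: j => [//|j IHj]; rewrite -addn1 PoszD.
exact: Fil_step vm _ IHj.
Qed.

(** Successive approximation: since $T$ is invertible on
    $t^j L/t^{j+1} L$ for $j \ge 1$, the error $T^n w$ can be pushed one step
    further into the filtration by a correction of the same order. *)
Lemma geneigen_lift v : Fil b 0 v ->
  exists2 w, Fil b 1 (w - v) & iter n T w = 0.
Proof.
move=> v0.
have step (j : nat) w : Fil b j.+1%:Z (iter n T w) ->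
    exists2 w', Fil b j.+1%:Z (w' - w) & Fil b j.+2%:Z (iter n T w').
  move=> wj; have j0 : j.+1%:Z != 0 by [].
  have Wlin (x : k) (u u' : restr V) : Fil b (j.+1%:Z + 1) u ->
    Fil b (j.+1%:Z + 1) u' -> Fil b (j.+1%:Z + 1) (x *: u + u').
    exact: Fil_linR.
  have Alin (x : k) (u u' : restr V) : Fil b j.+1%:Z u ->
    Fil b j.+1%:Z u' -> Fil b j.+1%:Z (x *: u + u').
    exact: Fil_linR.
  have [u uj] := coprime_solve T_linear (shift_neq0 j0) Wlin
    (@T_Fil_gen _) (@Fil_0 _ _ _ b j.+1%:Z) Alin (@T_Fil_gen _) n (@T_shift _)
    (Fil_N wj).
  rewrite opprK => uw; exists (w + u); first by rewrite addrC addKr.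
  by rewrite addrC iterT_D (_ : j.+2%:Z = j.+1%:Z + 1)//; lia.
(* Dependent choice: the corrections are only defined along the invariant. *)
pose P j w := Fil b j.+1%:Z (iter n T w).
have /choice[s sP] jw : exists w', P jw.1 jw.2 ->
    Fil b jw.1.+1%:Z (w' - jw.2) /\ P jw.1.+1 w'.
  case: (pselect (P jw.1 jw.2)) => [/step[w' ? ?]|nP]; first by exists w'.
  by exists 0.
pose w := fix w j := if j is j'.+1 then s (j', w j') else v.
have wP j : P j (w j).
  elim: j => [|j IHj]; first exact: T_nil.
  by have [] := sP (j, w j) IHj.
have wS j : Fil b j.+1%:Z (w j.+1 - w j) by have [] := sP (j, w j) (wP j).
have [l lw] := Fil_lim b_bij v0 wS; exists l; first exact: (lw 0%N).
apply: (Fil_sep b_bij) => j; apply: (@Fil_le _ _ _ _ j.+1%:Z); first by lia.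
rewrite -[l](subrK (w j)) iterT_D; apply: Fil_D; last exact: wP.
by elim: (n) => [|m IHm]; [exact: lw | exact: T_Fil_gen].
Qed.

(** Generalized eigenvectors are determined by their residue in $L/tL$, so
    they are the constant combinations of any such vectors lifting a basis. *)
Lemma geneigen_comb (w : 'I_d -> V) m v :
    (forall i, Fil b 1 (w i - b i)) -> (forall i, iter n T (w i) = 0) ->
    iter m T v = 0 ->
  exists x : 'rV[k]_d, v = comb (w : 'I_d -> restr V) x.
Proof.
move=> w1 wn vm.
have [x vx] := residue_lift w1 (geneigen_lattice vm); exists x.
apply/eqP; rewrite -subr_eq0; apply/eqP/(@geneigen_small (maxn m n)) => //.
have iterT_lin l := linear_iter l T_linear.
have iterT_kill l h u : (h <= l)%N -> iter h T u = 0 -> iter l T u = 0.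
  by move=> hl u0; rewrite -(subnK hl) iterD u0 (linear_fun0 (iterT_lin _)).
rewrite (linear_funB (iterT_lin _)) (iterT_kill _ m)// ?leq_maxl// sub0r.
rewrite /comb (linear_fun_sum (iterT_lin _)) big1 ?oppr0// => i _.
rewrite (linear_funZ (iterT_lin _)) (iterT_kill _ n _ (leq_maxr _ _) (wn i)).
by rewrite scaler0.
Qed.

(** Lifting a basis of $L/tL$ exhibits the generalized kernel of $T$ as a
    $k$-form of $V$. *)
Lemma geneigen_basis : exists w : 'I_d -> V,
  [/\ bijective (comb w), forall i, iter n T (w i) = 0 &
    forall m v, iter m T v = 0 ->
      exists x : 'rV[k]_d, v = comb (w : 'I_d -> restr V) x].
Proof.
have /choice[w wP] i : exists w, Fil b 1 (w - b i) /\ iter n T w = 0.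
  by have [w ? ?] := geneigen_lift (Fil_b b i); exists w.
have w1 i : Fil b 1 (w i - b i) by exact: (wP i).1.
have wn i : iter n T (w i) = 0 by exact: (wP i).2.
exists w; split=> [|//|m v vm]; first exact: (basis_lift b_bij w1).
exact: geneigen_comb vm.
Qed.

End RegularOperator.

(** * Lattices have bases *)

Section LatticeBasis.
Variables (k : fieldType) (V : lmodType (laurent k)).
Local Notation K := (laurent k).

Lemma pspan_Fil (s : seq V) :
  pspan s = Fil (fun i : 'I_(size s) => s`_i) 0.
Proof.
apply/funext => v; apply/propext; split=> [[c c0 ->]|[x x0 ->]].
  exists (\row_i c i) => [i|]; first by rewrite mxE; exact: c0.
  by apply: eq_bigr => i _; rewrite mxE.
exists (fun j => oapp (x 0) 0 (insub j)) => [j|].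
  by case: insub => [i|] //=; exact: x0.
by apply: eq_bigr => i _; rewrite valK.
Qed.

(** A dependency between generators can be solved for the one whose
    coefficient has the smallest valuation. *)
Lemma lattice_redundant d (b : 'I_d -> V) (x : 'rV[K]_d) :
    x != 0 -> comb b x = 0 ->
  exists i0 (y : 'rV[K]_d), [/\ forall i, vanish_below (y 0 i) 0,
    y 0 i0 = 0 & b i0 = comb b y].
Proof.
move=> x0 bx0; have [M xM] := row_vanish x.
have ex : exists m : nat, [exists i, x 0 i (- M%:Z + m%:Z) != 0].
  have [i xi] : exists i, x 0 i != 0.
    by apply/rV0Pn; exact: x0.
  have [a xa xa0] := valuation xi; exists (absz (a + M%:Z)).
  apply/existsP; exists i; have [aM|Ma] := ltP a (- M%:Z).
    by rewrite xM ?eqxx// in xa0.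
  by rewrite (_ : - M%:Z + _ = a)//; lia.
case: (ex_minnP ex) => m /existsP[i0 xi0] minm.
pose a := - M%:Z + m%:Z.
have xa i : vanish_below (x 0 i) a.
  move=> n na; have [nM|Mn] := ltP n (- M%:Z); first exact: xM.
  apply/eqP/negPn/negP => xn; have := minm (absz (n + M%:Z)).
  rewrite (_ : - M%:Z + _ = n); last by lia.
  have -> : [exists i, x 0 i n != 0] by apply/existsP; exists i.
  by move=> /(_ isT); rewrite /a in na; lia.
have xi00 : x 0 i0 != 0 by apply: contraNneq xi0 => ->; rewrite lcoef0.
exists i0, (delta_mx 0 i0 - (x 0 i0)^-1 *: x); split=> [i||].
- rewrite !mxE; apply: vanishD.
    by case: (_ && _) => //; exact: vanish_mono.
  move=> n n0; rewrite lcoefN; apply/eqP; rewrite oppr_eq0; apply/eqP.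
  by move: n n0; rewrite -(addNr a); apply: vanishM => //; exact: vanishV.
- by rewrite !mxE !eqxx mulVf// subrr.
- rewrite (linear_funB (comb_linear b)) (linear_funZ (comb_linear b)) bx0.
  by rewrite scaler0 subr0 comb_delta.
Qed.

(** A generating family of minimal size is free. *)
Lemma lattice_basis (L : set V) : lattice L ->
  exists d (b : 'I_d -> V), bijective (comb b) /\ L = Fil b 0.
Proof.
pose P d := exists b : 'I_d -> V, (forall v, exists x, v = comb b x) /\ L = Fil b 0.
move=> [s [Ls sV]].
have ex : exists d, `[< P d >].
  exists (size s); apply/asboolP; exists (fun i => s`_i); rewrite -pspan_Fil.
  split=> // v; have [c ->] := sV v; exists (\row_i c i).
  by apply: eq_bigr => i _; rewrite mxE.
case: (ex_minnP ex) => d /asboolP[b [b_surj Lb]] mind; exists d, b; split=> //.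
have b_free x : comb b x = 0 -> x = 0.
  move=> bx0; apply/eqP/negPn/negP => x0.
  have [i0 [y [y0 yi0 by0]]] := lattice_redundant x0 bx0.
  case: d => [|d] in b x i0 y b_surj Lb mind bx0 x0 y0 yi0 by0 *.
    by case: i0 {yi0 by0} => [].
  suff /asboolP/mind : P d by rewrite ltnn.
  pose b' j := b (lift i0 j).
  pose r (x : 'rV[K]_d.+1) : 'rV[K]_d := \row_j (x + x 0 i0 *: y) 0 (lift i0 j).
  have bb' x' : comb b x' = comb b' (r x').
    have -> : comb b x' = comb b (x' + x' 0 i0 *: y - x' 0 i0 *: delta_mx 0 i0).
      rewrite (linear_funB (comb_linear b)) (linear_funD (comb_linear b)).
      by rewrite !(linear_funZ (comb_linear b)) comb_delta by0 addrK.
    rewrite {1}/comb (bigD1_ord i0)//= !mxE yi0 !eqxx mulr0 addr0 mulr1 subrr.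
    rewrite scale0r add0r; apply: eq_bigr => j _.
    by rewrite !mxE eqxx [lift _ _ == _]eq_sym (negPf (neq_lift _ _)) mulr0 subr0.
  exists b'; split=> [v|].
    by have [x' ->] := b_surj v; exists (r x'); exact: bb'.
  apply/funext => v; rewrite Lb; apply/propext; split=> [[x' x'0 ->]|[x' x'0 ->]].
    exists (r x'); last exact: bb'.
    move=> i; rewrite !mxE; apply: vanishD => //.
    by rewrite -[(0 : int)]addr0; apply: vanishM.
  by apply: Fil_sum => j; rewrite -[_ *: _]addr0; apply: Fil_lin => //;
    [exact: Fil_b | exact: Fil_0].
have /choice[g gK] v : exists x, comb b x = v by have [x ->] := b_surj v; exists x.
exists g => // x; apply/eqP; rewrite -subr_eq0; apply/eqP/b_free.
by rewrite (linear_funB (comb_linear b)) gK subrr.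
Qed.

Lemma basis_lattice d (b : 'I_d -> V) : bijective (comb b) -> lattice (Fil b 0).
Proof.
move=> b_bij; exists [seq b i | i <- enum 'I_d].
have sE (c : nat -> K) :
    \sum_(i < size [seq b i | i <- enum 'I_d]) c i *: [seq b i | i <- enum 'I_d]`_i
      = comb b (\row_i c i).
  rewrite -(big_mkord xpredT (fun i => c i *: _`_i)) size_map size_enum_ord.
  rewrite big_mkord; apply: eq_bigr => i _; rewrite mxE; congr (_ *: _).
  by rewrite (nth_map i) ?size_enum_ord// nth_ord_enum.
pose ext (x : 'rV[K]_d) j : K := oapp (x 0) 0 (insub j).
have xE (x : 'rV[K]_d) : x = \row_i ext x i.
  by apply/rowP => i; rewrite mxE /ext valK.
split=> [|v]; last first.
  by have [x ->] := comb_surj b_bij v; exists (ext x); rewrite sE -xE.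
apply/funext => v; apply/propext; split=> [[x x0 ->]|[c c0 ->]].
  exists (ext x); last by rewrite sE -xE.
  by rewrite /ext => j; case: insub => [i|] //=; exact: x0.
by exists (\row_i c i) => [i|]; rewrite ?mxE ?sE//; exact: c0.
Qed.

End LatticeBasis.

Lemma finite_dim_basis (R : fieldType) (V : lmodType R) : finite_dim V ->
  exists d (b : 'I_d -> V), bijective (comb b).
Proof.
move=> [d [[f lf [g fK gK]]]]; exists d, (fun i => g (delta_mx 0 i)).
have gE x : comb (fun i => g (delta_mx 0 i)) x = g x.
  apply: (can_inj fK); rewrite gK /comb (linear_fun_sum lf).
  rewrite [RHS]row_sum_delta; apply: eq_bigr => i _.
  by rewrite (linear_funZ lf) gK.
by exists f => x; rewrite ?gE ?gK ?fK.
Qed.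

Lemma linear_can (R : fieldType) (U V : lmodType R) (f : U -> V) g :
  linear f -> cancel f g -> cancel g f -> linear g.
Proof. by move=> lf fK gK a x y; rewrite -{1}[x]gK -{1}[y]gK -lf fK. Qed.

Lemma basis_finite_dim (R : fieldType) (V : lmodType R) d (b : 'I_d -> V) :
  bijective (comb b) -> finite_dim V.
Proof.
move=> [g bK gK]; exists d; constructor; exists g; last by exists (comb b).
exact: linear_can (comb_linear b) bK gK.
Qed.

(** * Linear bijections are homeomorphisms *)

Section Homeomorphism.
Variables (k : fieldType).
Local Notation K := (laurent k).

(** Openness of a subspace only refers to the $k((t))$-module structure, so
    preimages of open subspaces under $k((t))$-linear maps are open. *)
Lemma linear_continuous (V W : lmodType K) (f : V -> W) : linear f ->
  continuous (f : adic V -> adic W).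
Proof.
move=> lf; apply/continuousP => A oA; change (adic_open (f @^-1` A)%classic).
move=> v; move: (oA : adic_open A) => /[apply] -[U [U0 UD Us] UA].
exists (fun u => U (f u)) => [|u Uu]; last first.
  by rewrite /preimage /mkset (linear_funD lf); exact: UA.
split; first by rewrite (linear_fun0 lf).
  by move=> a u w Uu Uw; rewrite lf; exact: UD.
move=> s; have [n Un] := Us [seq f x | x <- s]; exists n => w [c c0 ->].
rewrite (linear_funZ lf); apply: Un; exists c => //.
rewrite (linear_fun_sum lf) size_map; apply: eq_bigr => i _.
by rewrite (linear_funZ lf) (nth_map 0).
Qed.

Lemma linear_homeomorphism (V W : lmodType K) (f : V -> W) :
  linear f -> bijective f -> homeomorphism (f : adic V -> adic W).
Proof.
move=> lf [g fK gK]; exists g; split=> //; first exact: linear_continuous.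
exact: linear_continuous (linear_can lf fK gK).
Qed.

End Homeomorphism.

(** * Bijective morphisms and natural isomorphisms *)

Section Isomorphisms.
Variable k : fieldType.

Lemma DK_bij_iso (M N : DKmodule k) (f : @Defs.hom (ModDK k) M N) :
  bijective (sval f) -> is_iso f.
Proof.
case: f => f [/= lf fd] [g fK gK].
have hg : DKhom g.
  split; first exact: linear_can lf fK gK.
  by move=> v; apply: (can_inj fK); rewrite fd !gK.
exists (exist _ g hg).
by split; apply: concrete_homP; apply/funext => v; [exact: fK | exact: gK].
Qed.

Lemma nil_bij_iso (M N : nilmodule k) (f : @Defs.hom (ModFin k) M N) :
  bijective (sval f) -> is_iso f.
Proof.
case: f => f [/= lf fp] [g fK gK].
have hg : nilhom g.
  split; first exact: linear_can lf fK gK.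
  by move=> v; apply: (can_inj fK); rewrite fp !gK.
exists (exist _ g hg).
by split; apply: concrete_homP; apply/funext => v; [exact: fK | exact: gK].
Qed.

Lemma Delta_bij_iso (M N : Deltamodule k) (f : @Defs.hom (ModDelta k) M N) :
  bijective (sval f) <-> is_iso f.
Proof.
case: f => f [/= lf fz ft]; split=> [[g fK gK]|[[g hg] [/= gf fg]]]; last first.
  exists g => v.
    exact: (congr1 (fun h : {h | @Deltahom k M M h} => sval h v) gf).
  exact: (congr1 (fun h : {h | @Deltahom k N N h} => sval h v) fg).
have hg : Deltahom g.
  split; first exact: linear_can lf fK gK.
  - by move=> v; apply: (can_inj fK); rewrite fz !gK.
  - by move=> v; apply: (can_inj fK); rewrite ft !gK.
exists (exist _ g hg).
by split; apply: concrete_homP; apply/funext => v; [exact: fK | exact: gK].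
Qed.

End Isomorphisms.

Section NatIso.
Variables (C D : category).

Lemma is_iso_comp (A B B' : D) (f : Defs.hom B B') (g : Defs.hom A B) :
  is_iso f -> is_iso g -> is_iso (mcomp f g).
Proof.
move=> [f' [f'f ff']] [g' [g'g gg']]; exists (mcomp g' f'); split.
  by rewrite mcompA -(mcompA g') f'f mcompm1.
by rewrite mcompA -(mcompA f) gg' mcompm1.
Qed.

Lemma nat_iso_quotient (F G H : functor C D) (a : nat_iso F G) (b : nat_iso F H) :
  inhabited (nat_iso G H).
Proof.
pose a' A := sval (cid (niso_iso a A)).
have a'P A : mcomp (a' A) (a A) = idm _ /\ mcomp (a A) (a' A) = idm _.
  exact: svalP (cid (niso_iso a A)).
constructor; exists (fun A => mcomp (b A) (a' A)) => [A B u|A]; last first.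
  apply: is_iso_comp; first exact: niso_iso.
  by exists (a A); have [] := a'P A.
rewrite mcompA niso_natural -!mcompA; congr (mcomp _ _).
rewrite -[LHS]mcomp1m -(a'P B).1 -!mcompA; congr (mcomp _ _).
by rewrite mcompA -niso_natural -mcompA (a'P A).2 mcompm1.
Qed.

End NatIso.

(** * The generalized kernel of an endomorphism *)

Section GenKernel.
Variables (k : fieldType) (U : lmodType k) (T : U -> U).

(** Linearity of $T$ is a parameter, so that the subspace structure can be
    inferred from the term itself. *)
Definition gker of linear T : {pred U} :=
  fun v => `[< exists n, iter n T v = 0 >].

Variable T_linear : linear T.

Lemma gkerP v : reflect (exists n, iter n T v = 0) (v \in gker T_linear).
Proof. exact: asboolP. Qed.

Fact gker_submod : submod_closed (gker T_linear).
Proof.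
split=> [|a u v /gkerP[m um] /gkerP[n vn]]; first by apply/gkerP; exists 0%N.
have iter_lin l := linear_iter l T_linear.
apply/gkerP; exists (m + n)%N.
rewrite iter_lin {1}addnC !iterD um vn !(linear_fun0 (iter_lin _)).
by rewrite scaler0 addr0.
Qed.

HB.instance Definition _ :=
  GRing.isSubmodClosed.Build k U (gker T_linear) gker_submod.

Record genker := GenKer { genker_val :> U; _ : genker_val \in gker T_linear }.

HB.instance Definition _ := [isSub for genker_val].
HB.instance Definition _ := [Choice of genker by <:].
HB.instance Definition _ := [SubChoice_isSubLmodule of genker by <:].

Lemma genkerP (v : genker) : exists n, iter n T v = 0.
Proof. exact/gkerP/(valP v). Qed.

Fact gker_stable (v : genker) : T v \in gker T_linear.
Proof.
have [n vn] := genkerP v; apply/gkerP; exists n.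
by rewrite -iterSr iterS vn (linear_fun0 T_linear).
Qed.

Definition genker_op (v : genker) : genker := GenKer (gker_stable v).

Lemma genker_op_linear : linear genker_op.
Proof. by move=> a u v; apply: val_inj; rewrite /= T_linear. Qed.

Lemma iter_genker_op n v : iter n genker_op v = iter n T v :> U.
Proof. by elim: n => //= n ->. Qed.

End GenKernel.

(** * Extension of scalars to Laurent series *)

Section KTensor.
Variables (k : fieldType) (N : lmodType k).
Local Notation K := (laurent k).

Lemma kpure_linear (f : K) : linear (kpure f : N -> restr (ktensor N)).
Proof. by move=> a m m'; rewrite restr_tensorE; exact: (tpure_bilin K N).2. Qed.

Lemma kpureE (f : K) (m : N) : kpure f m = f *: kpure 1 m.
Proof. by rewrite kscale_pure mulr1. Qed.

Lemma ktensor_ind (P : ktensor N -> Prop) :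
    (forall x y, P x -> P y -> P (x + y)) -> (forall f m, P (kpure f m)) ->
  forall x, P x.
Proof.
move=> PD Pp x; have P0 : P 0.
  have := Pp 0 0; rewrite kpureE scale0r; exact.
by rewrite (tensor_sumE x); elim/big_rec: _ => // -[f m] y _ Py; apply: PD => //; exact: Pp.
Qed.

Section Mult.
Variables (V : lmodType K) (j : N -> V).
Hypothesis j_linear : linear (j : N -> restr V).

Definition kmult (x : ktensor N) : V :=
  tlift (fun f m => f *: j m : restr V) x.

Fact kmult_bilin : bilin (fun (f : K) m => f *: j m : restr V).
Proof.
split=> [m a f g|f a m m'] /=.
  by rewrite restr_scaleE scalerDl scalerA -scalerAl mul1r.
by rewrite j_linear !restr_scaleE scalerDr !scalerA mulrC.
Qed.

Lemma kmult_pure f m : kmult (kpure f m) = f *: j m.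
Proof. exact: tlift_pure kmult_bilin. Qed.

Lemma kmultD x y : kmult (x + y) = kmult x + kmult y.
Proof.
exact: (@linear_funD k (tensor K N) (restr V) _ (tlift_linear kmult_bilin) x y).
Qed.

Lemma kmult_linear : linear kmult.
Proof.
move=> f x y; rewrite kmultD; congr (_ + _); move: x; apply: ktensor_ind.
  by move=> u v IHu IHv; rewrite scalerDr !kmultD IHu IHv scalerDr.
by move=> g m; rewrite kscale_pure !kmult_pure scalerA.
Qed.

End Mult.

Lemma comb_restr (V : lmodType K) d (w : 'I_d -> V) (x : 'rV[k]_d) :
  comb (w : 'I_d -> restr V) x = comb w (map_mx (fun a => a%:A : K) x).
Proof. by apply: eq_bigr => i _; rewrite mxE. Qed.

Variables (d : nat) (e : 'I_d -> N).
Hypothesis e_bij : bijective (comb e).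

Lemma comb_image (V : lmodType K) (j : N -> V) x :
    linear (j : N -> restr V) ->
  j (comb e x) = comb (fun i => j (e i)) (map_mx (fun a => a%:A : K) x).
Proof.
move=> lj; rewrite -comb_restr /comb (linear_fun_sum lj).
by apply: eq_bigr => i _; rewrite (linear_funZ lj).
Qed.

(** The inverse of the coordinate map is obtained by extending scalars in the
    coordinates of $N$. *)
Lemma ktensor_basis : bijective (comb (fun i => kpure 1 (e i) : ktensor N)).
Proof.
have [g eK gK] := e_bij.
pose j m : 'rV[K]_d := map_mx (fun a => a%:A : K) (g m).
have j_linear : linear (j : N -> restr 'rV[K]_d).
  move=> a m m'; apply/rowP => i.
  rewrite restr_scaleE !mxE (linear_can (comb_linear e) eK gK) !mxE.
  by rewrite scalerDl -scalerAl mul1r scalerA.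
exists (kmult j) => [x|].
  rewrite /comb (linear_fun_sum (kmult_linear j_linear)) [RHS]row_sum_delta.
  apply: eq_bigr => i _; rewrite (linear_funZ (kmult_linear j_linear)).
  rewrite (kmult_pure j_linear) scale1r; congr (_ *: _).
  rewrite /j -[e i](comb_delta e) eK; apply/rowP => l; rewrite !mxE.
  by case: (_ && _); rewrite ?scale1r ?scale0r.
apply: ktensor_ind => [x y IHx IHy|f m].
  by rewrite (kmultD j_linear) (linear_funD (comb_linear _)) IHx IHy.
rewrite (kmult_pure j_linear) (linear_funZ (comb_linear _)).
by rewrite -(comb_image _ (kpure_linear 1)) gK -kpureE.
Qed.

(** A $k$-form of $V$ generates it freely: a $k$-basis of $N$ is a
    $k((t))$-basis on both sides. *)
Lemma kmult_bij (V : lmodType K) (j : N -> V) : linear (j : N -> restr V) ->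
  bijective (comb (fun i => j (e i))) -> bijective (kmult j).
Proof.
move=> lj jb; have [g bK gK] := ktensor_basis.
apply: (@eq_bij _ _ (comb (fun i => j (e i)) \o g)).
  by apply: bij_comp => //; exists (comb (fun i => kpure 1 (e i))).
move=> x; rewrite /= -[in RHS](gK x).
rewrite {2}/comb (linear_fun_sum (kmult_linear lj)); apply: eq_bigr => i _.
by rewrite (linear_funZ (kmult_linear lj)) (kmult_pure lj) scale1r.
Qed.

Lemma Fil_kpure a (f : K) m : vanish_below f a ->
  Fil (fun i => kpure 1 (e i) : ktensor N) a (kpure f m).
Proof.
move=> fa; have [g _ gK] := e_bij.
exists (f *: map_mx (fun a => a%:A : K) (g m)) => [i|].
  by rewrite !mxE -[a]addr0; apply: vanishM => //; exact: vanish_alg.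
rewrite (linear_funZ (comb_linear _)) -(comb_image _ (kpure_linear 1)) gK.
exact: kpureE.
Qed.

End KTensor.

(** * The operator $z$ on a module over differential operators *)

(** The two cases of the theorem are treated at once by a sign $e$.  In the
    coordinate $t = x$ at $0$, $z = t\partial_t$ and $e = 1$; in the
    coordinate $t = x^{-1}$ at infinity, $z = -t\partial_t$ and $e = -1$.  The
    leading term $q$ of $t\partial_t$ is $ep$, and $z$ multiplies $t^n$ in
    $\iota_{p!}$ by $c_n = p + en$, that is, by $p \pm n$. *)
Section ZOperator.
Variables (k : fieldType).
Local Notation K := (laurent k).
Variables (e p q : k) (c : int -> k).
Hypothesis ee : e * e = 1.
Hypothesis qE : q = e * p.
Hypothesis cE : forall n, c n = p + e * n%:~R.

Lemma t_deriv (f : K) : lmono k 1 * lderiv f = lhad (fun n => n%:~R) f.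
Proof. by apply: laurentP => n; rewrite lcoef_monoM /= subrK. Qed.

Lemma lhad_c f : lhad c f = p *: f + e *: (lmono k 1 * lderiv f).
Proof.
by rewrite t_deriv; apply: laurentP => n; rewrite /= cE mulrDl mulrA.
Qed.

Section Module.
Variable F : DKmodule k.

Definition DKz (v : F) : F := (e%:A : K) *: DKtheta v.
Definition DKpi (v : F) : F := DKz v - (p%:A : K) *: v.

(** The Leibniz rule for $z$ in the form of the action on
    $k((t)) \otimes N$: the weights $c_n$ on the coefficients of $f$, plus
    $\pi = z - p$ on $v$. *)
Lemma DKz_scale (f : K) v : DKz (f *: v) = lhad c f *: v + f *: DKpi v.
Proof.
rewrite lhad_c /DKpi /DKz /DKtheta DKdZ !scalerDr !scalerN scalerDl !scalerA.
rewrite !mulr_algl !mulr_algr -!scalerAl [f * _]mulrC.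
by rewrite [_ *: v + _ *: v]addrC addrACA subrr addr0 addrC.
Qed.

Lemma DKpi_linear : linear (DKpi : restr F -> restr F).
Proof.
move=> a u v; rewrite /DKpi /DKz /DKtheta; have := DKd_linear a u v => /= ->.
rewrite !restr_scaleE !scalerDr opprD addrACA scalerN; congr (_ + _).
by rewrite !scalerA ![_ * a%:A]mulrC.
Qed.

Lemma DKpi_mono j v :
  DKpi (lmono k j *: v) = lmono k j *: (DKpi v + ((e * j%:~R)%:A : K) *: v).
Proof.
rewrite {1}/DKpi DKz_scale addrAC [RHS]scalerDr [RHS]addrC; congr (_ + _).
rewrite !scalerA -scalerBl mulr_algl mulr_algr; congr (_ *: _).
apply: laurentP => n; rewrite lcoefD lcoefN !lcoefZ /= cE mulrDl addrAC subrr.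
by rewrite add0r; case: eqP => [->//|_]; rewrite !mulr0.
Qed.

(** $t\partial_t - q = e(z - p)$, because $e^2 = 1$ and $q = ep$. *)
Lemma iter_DKpi n v :
  iter n (fun u => DKtheta u - (q%:A : K) *: u) v =
  ((e ^+ n)%:A : K) *: iter n DKpi v.
Proof.
have sE (a b : k) : (a%:A * b%:A : K) = (a * b)%:A.
  by rewrite -scalerAl mul1r scalerA.
elim: n => [|n IHn]; first by rewrite expr0 !scale1r.
rewrite !iterS IHn; have eE u : DKtheta u - (q%:A : K) *: u = (e%:A : K) *: DKpi u.
  by rewrite /DKpi /DKz scalerBr ![e%:A *: (_ *: _)]scalerA !sE ee !scale1r -qE.
rewrite eE exprSr -sE mulrC -scalerA; congr (_ *: _).
exact: (linear_funZ DKpi_linear (e ^+ n)).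
Qed.

(** The condition of regular singularity on the basis $b$ of a lattice, with
    the exponent moved to $0$ by passing from $t\partial_t$ to $z - p$. *)
Definition adapted d (b : 'I_d -> F) n :=
  [/\ bijective (comb b), forall v, Fil b 0 v -> Fil b 0 (DKpi v) &
    forall v, Fil b 0 v -> Fil b 1 (iter n DKpi v)].

Let Fil_alg d (b : 'I_d -> F) a (x : k) v : Fil b a v -> Fil b a ((x%:A : K) *: v).
Proof.
move=> va; rewrite -[_ *: _]addr0; apply: Fil_lin => //; last exact: Fil_0.
exact: vanish_alg.
Qed.

Lemma reg_sing_adapted : reg_sing q F ->
  exists d (b : 'I_d -> F) n, adapted b n.
Proof.
move=> [_ [L [/lattice_basis[d [b [b_bij ->]]] Lth [n Ln]]]]; exists d, b, n.
split=> // v v0.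
  by apply: Fil_D; [|apply: Fil_N]; apply: Fil_alg => //; exact: Lth.
have [w w0] := Ln _ v0; rewrite iter_DKpi => vw.
rewrite -[iter n _ _]scale1r (_ : 1 = (e ^+ n)%:A * (e ^+ n)%:A :> K).
  rewrite -scalerA vw; apply: Fil_alg; rewrite -[1]addr0; exact: Fil_mono.
by rewrite -scalerAl mul1r scalerA -exprMn ee expr1n scale1r.
Qed.

Lemma adapted_reg_sing d (b : 'I_d -> F) n : adapted b n -> reg_sing q F.
Proof.
move=> [b_bij bT bn]; split; first exact: basis_finite_dim b_bij.
exists (Fil b 0); split; first exact: basis_lattice.
  move=> v v0; have -> : DKtheta v = (e%:A : K) *: (DKpi v + (p%:A : K) *: v).
    by rewrite subrK /DKz [e%:A *: (e%:A *: _)]scalerA mulr_algl scalerA ee !scale1r.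
  by apply/Fil_alg/Fil_D; [exact: bT | exact: Fil_alg].
exists n => v v0; rewrite iter_DKpi; apply: Fil_monoP; apply: Fil_alg; exact: bn.
Qed.

End Module.

End ZOperator.

(** * The equivalence with nilpotent endomorphisms *)

Section Equivalence.
Variables (k : fieldType).
Local Notation K := (laurent k).
Hypothesis char0 : [pchar k] =i pred0.
Variables (e p q : k) (c : int -> k).
Hypothesis ee : e * e = 1.
Hypothesis qE : q = e * p.
Hypothesis cE : forall n, c n = p + e * n%:~R.

Let e_neq0 : e != 0.
Proof. by apply: contra_eq_neq ee => ->; rewrite mul0r eq_sym oner_eq0. Qed.

Notation T := (@DKpi k e p _).
Notation geneigen F := (genker (@DKpi_linear k e p F)).
Notation mk_geneigen := (@GenKer k (restr _) _ (@DKpi_linear k e p _) _).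

Lemma geneigen_val_linear (F : DKmodule k) :
  linear (fun v : geneigen F => (v : F) : restr F).
Proof. by []. Qed.

(** Regular singularity enters the equivalence only through this basis: it
    makes the generalized eigenspace finite dimensional, with $z - p$
    nilpotent on it, and shows that it spans $F$ freely over $k((t))$. *)
Lemma genker_basis (F : DKmodule k) : reg_sing q F ->
  exists d (w : 'I_d -> geneigen F) n,
    [/\ bijective (comb w), bijective (comb (fun i => w i : F)) &
      forall v : geneigen F, iter n T (v : F) = 0].
Proof.
move=> /(reg_sing_adapted ee qE)[d [b [n [b_bij bT bn]]]].
have [w [w_bij wn w_comb]] := geneigen_basis char0 b_bij e_neq0
  (@DKpi_linear k e p F) (@DKpi_mono k e p c cE F) bT bn.
have wP i : w i \in gker (@DKpi_linear k e p F).
  by apply/(gkerP (@DKpi_linear k e p F)); exists n; exact: wn.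
pose w' i := mk_geneigen (wP i); exists d, w', n.
have w'E x : comb w' x = comb (w : 'I_d -> restr F) x :> F.
  exact: (linear_fun_sum (@geneigen_val_linear F)).
split=> // [|v]; last first.
  have [m vm] := genkerP v; have [x ->] := w_comb _ _ vm.
  rewrite /comb (linear_fun_sum (linear_iter n (@DKpi_linear k e p F))) big1// => i _.
  by rewrite (linear_funZ (linear_iter n (@DKpi_linear k e p F))) wn scaler0.
have /choice[g gK] (v : geneigen F) : exists x, comb w' x = v.
  have [m vm] := genkerP v; have [x vx] := w_comb _ _ vm; exists x.
  by apply: val_inj; exact: etrans (w'E x) (esym vx).
exists g => // x; have := gK (comb w' x) => /(congr1 (fun v : geneigen F => v : F)).
rewrite !w'E !comb_restr => /(bij_inj w_bij)/matrixP xg; apply/rowP => i.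
have := congr1 (fun f : K => f 0) (xg 0 i); rewrite !mxE !algE.
by rewrite eqxx !mulr1.
Qed.

Section Object.
Variables (F : DKmodule k) (F_reg : reg_sing q F).

Fact geneigen_finite : finite_dim (geneigen F).
Proof. by have [d [w [n [/basis_finite_dim]]]] := genker_basis F_reg. Qed.

Fact geneigen_nil : exists n, forall v : geneigen F,
  iter n (@genker_op _ _ _ (@DKpi_linear k e p F)) v = 0.
Proof.
have [d [w [n [_ _ nP]]]] := genker_basis F_reg; exists n => v.
by apply: val_inj; rewrite /= iter_genker_op nP.
Qed.

Definition geneigen_obj : nilmodule k :=
  NilModule (@genker_op_linear _ _ _ (@DKpi_linear k e p F))
    geneigen_finite geneigen_nil.

End Object.

Lemma DKz_hom (F F' : DKmodule k) (f : F -> F') v : DKhom f ->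
  f (DKz e v) = DKz e (f v).
Proof. by move=> hf; rewrite /DKz /DKtheta !(DKhomZ _ _ hf) hf.2. Qed.

Lemma DKpi_hom (F F' : DKmodule k) (f : F -> F') v : DKhom f ->
  f (T v) = T (f v).
Proof.
by move=> hf; rewrite /DKpi (linear_funB hf.1) (DKz_hom _ hf) (DKhomZ _ _ hf).
Qed.

Section Morphism.
Variables (F F' : DKmodule k) (f : F -> F') (hf : DKhom f).

Fact geneigen_map_subproof (v : geneigen F) :
  f v \in gker (@DKpi_linear k e p F').
Proof.
have [n vn] := genkerP v; apply/(gkerP (@DKpi_linear k e p F')); exists n.
have fi m : f (iter m T (v : F)) = iter m T (f v).
  by elim: m => //= m <-; rewrite (DKpi_hom _ hf).
by rewrite -fi vn (linear_fun0 hf.1).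
Qed.

Definition geneigen_map (v : geneigen F) : geneigen F' :=
  mk_geneigen (geneigen_map_subproof v).

Fact geneigen_map_hom (rF : reg_sing q F) (rF' : reg_sing q F') :
  @nilhom k (geneigen_obj rF) (geneigen_obj rF') geneigen_map.
Proof.
split=> [a u v|v]; apply: val_inj; last exact: DKpi_hom.
exact: (DKhom_restr_linear hf).
Qed.

End Morphism.

Definition geneigen_functor : functor (HolReg q) (ModFin k).
Proof.
exists (fun F => geneigen_obj (svalP F))
  (fun F F' u => exist _ (geneigen_map (svalP u))
                   (geneigen_map_hom (svalP u) (svalP F) (svalP F'))).
- by move=> F; apply: concrete_homP; apply/funext => v; apply: val_inj.
- by move=> F1 F2 F3 u v; apply: concrete_homP; apply/funext => x; apply: val_inj.
Defined.

Section Extension.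
Variable N : nilmodule k.

Lemma iota_zD x y : iota_z c (x + y : ktensor N) = iota_z c x + iota_z c y.
Proof. exact: (linear_funD (iota_z_tlinear c (N := N))). Qed.

Lemma iota_z_scale (f : K) (x : ktensor N) :
  iota_z c (f *: x) = f *: iota_z c x + (e *: (lmono k 1 * lderiv f)) *: x.
Proof.
move: x; apply: ktensor_ind => [x y IHx IHy|g m].
  by rewrite scalerDr !iota_zD IHx IHy !scalerDr addrACA.
rewrite kscale_pure !iota_z_pure scalerDr !kscale_pure addrAC -kpureDl.
congr (kpure _ _ + _); rewrite !(lhad_c cE) lderivM mulrDr mulrDr.
rewrite -!scalerAr -!scalerAl scalerDr -addrA; congr (_ + _).
by rewrite addrC mulrA [in RHS]mulrCA.
Qed.

(** $\partial_t$ recovered from $z = e\, t\partial_t$ on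
    $k((t)) \otimes N$. *)
Definition ext_d (x : ktensor N) : ktensor N :=
  (e *: lmono k (-1)) *: iota_z c x.

Fact ext_dD x y : ext_d (x + y) = ext_d x + ext_d y.
Proof. by rewrite /ext_d iota_zD scalerDr. Qed.

Fact ext_dZ (f : K) x : ext_d (f *: x) = f *: ext_d x + lderiv f *: x.
Proof.
rewrite /ext_d iota_z_scale scalerDr !scalerA [_ * f]mulrC; congr (_ + _ *: _).
by rewrite -scalerAl -scalerAr scalerA ee scale1r mulrA -lmonoD mul1r.
Qed.

Definition ext_obj : DKmodule k := DKModule ext_dD ext_dZ.

Lemma ext_z (x : ext_obj) : DKz e x = iota_z c (x : ktensor N).
Proof.
rewrite /DKz /DKtheta /= /ext_d !scalerA mulr_algl -scalerAl -scalerAr.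
by rewrite scalerA ee scale1r -lmonoD scale1r.
Qed.

Lemma ext_T_pure f m :
  T (kpure f m : ext_obj) = kpure (lhad c f - p *: f) m + kpure f (Npi m).
Proof.
rewrite /DKpi ext_z iota_z_pure kscale_pure mulr_algl addrAC; congr (_ + _).
by rewrite kpureDl; congr (_ + _); rewrite -scaleN1r kscale_pure mulN1r.
Qed.

Lemma ext_T_pure1 m : T (kpure 1 m : ext_obj) = kpure 1 (Npi m).
Proof.
rewrite ext_T_pure (_ : lhad c 1 - _ = 0); last first.
  apply: laurentP => n; rewrite lcoefD lcoefN lcoefZ lcoef_had cE /=.
  by case: eqP => [->|_]; rewrite ?mulr0 ?addr0 ?subrr.
by rewrite [kpure 0 m]kpureE scale0r add0r.
Qed.

Lemma iter_ext_T_pure1 n m :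
  iter n T (kpure 1 m : ext_obj) = kpure 1 (iter n (@Npi k N) m).
Proof. by elim: n => //= n ->; rewrite ext_T_pure1. Qed.

(** The lattice $k[[t]] \otimes N$ shows that $k((t)) \otimes N$ is regular
    singular. *)
Lemma ext_adapted : exists d (b : 'I_d -> N) n,
  [/\ bijective (comb b), forall m, iter n (@Npi k N) m = 0 &
    @adapted k e p ext_obj d (fun i => kpure 1 (b i)) n].
Proof.
have [d [b b_bij]] := finite_dim_basis (Nfin N); have [n nN] := Nnil N.
exists d, b, n; split=> //.
pose b1 i : ext_obj := kpure 1 (b i).
have Fil_T a (f : K) m : vanish_below f a -> Fil b1 a (T (kpure f m : ext_obj)).
  move=> fa; rewrite ext_T_pure; apply: Fil_D; apply: Fil_kpure => //.
  by move=> i ia; rewrite lcoefD lcoefN lcoefZ lcoef_had fa// !mulr0 subrr.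
have Fil_TT a x : Fil b1 a x -> Fil b1 a (T x).
  move=> [y ya ->]; rewrite /comb.
  rewrite (linear_fun_sum (@DKpi_linear k e p ext_obj)).
  by apply: Fil_sum => i; rewrite kscale_pure mulr1; exact: Fil_T.
split; [exact: ktensor_basis | exact: Fil_TT |].
move=> x [y y0 ->]; rewrite /comb.
rewrite (linear_fun_sum (linear_iter n (@DKpi_linear k e p ext_obj))).
apply: Fil_sum => i.
(* Up to $t L$ the coefficient is a constant $a$, and $T^n$ kills
   $a \otimes b_i$. *)
pose a := y 0 i 0; have -> : y 0 i = a%:A + (y 0 i - a%:A) by rewrite addrC subrK.
rewrite scalerDl (linear_funD (linear_iter n (@DKpi_linear k e p ext_obj))).
rewrite (linear_funZ (linear_iter n (@DKpi_linear k e p ext_obj)) a).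
rewrite iter_ext_T_pure1 nN (linear_fun0 (kpure_linear _)) scaler0 add0r.
elim: (n) => [|m IHm]; last exact: Fil_TT.
by rewrite kscale_pure mulr1; apply: Fil_kpure; last exact: vanish_sub_const.
Qed.

Fact ext_reg : reg_sing q ext_obj.
Proof.
have [d [b [n [_ _ bn]]]] := ext_adapted.
exact: (adapted_reg_sing ee qE bn).
Qed.

(** Generalized eigenvectors of $z$ at $p$ in $k((t)) \otimes N$ have degree
    $0$, since $1 \otimes N$ already consists of such vectors and reduces onto
    the quotient of the lattice by $t$. *)
Lemma ext_geneigen m (x : ext_obj) : iter m T x = 0 ->
  exists y : N, x = kpure 1 y.
Proof.
have [d [b [n [_ nN [b_bij bT bn]]]]] := ext_adapted => xm.
have [|i|y ->] := geneigen_comb char0 b_bij e_neq0 (@DKpi_linear k e p ext_obj)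
  (@DKpi_mono k e p c cE ext_obj) bT bn (w := fun i => kpure 1 (b i)) _ _ xm.
- by move=> i; rewrite subrr; exact: Fil_0.
- by rewrite iter_ext_T_pure1 nN (linear_fun0 (kpure_linear 1)).
exists (comb b y); rewrite comb_restr.
by rewrite -(comb_image _ _ (kpure_linear 1)).
Qed.

(** The projection of $k((t)) \otimes N$ onto $1 \otimes N$. *)
Definition kres (x : ktensor N) : N :=
  tlift (fun f m => (f : K) 0 *: m : N) x.

Fact kres_bilin : bilin (fun (f : K) m => f 0 *: m : N).
Proof.
split=> [m a f g|f a m m'] /=.
  by rewrite scalerDl scalerA.
by rewrite scalerDr !scalerA mulrC.
Qed.

Lemma kres_pure1 m : kres (kpure 1 m) = m.
Proof. by rewrite [LHS](tlift_pure _ _ kres_bilin) /= scale1r. Qed.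

Lemma kres_linear : linear (kres : restr (ktensor N) -> N).
Proof. by move=> a x y; rewrite restr_tensorE; exact: (tlift_linear kres_bilin). Qed.

Lemma geneigen_kres m (x : ext_obj) : iter m T x = 0 -> kpure 1 (kres x) = x.
Proof. by move=> /ext_geneigen[y ->]; rewrite kres_pure1. Qed.

End Extension.

Fact ext_hom (M N : nilmodule k) (u : M -> N) : nilhom u ->
  @DKhom k (ext_obj M) (ext_obj N) (iota_map u).
Proof.
move=> hu; have uD := linear_funD (iota_map_tlinear hu.1).
split=> [f x y|x]; first by rewrite [LHS]uD iota_map_scale//; exact: hu.1.
by rewrite /= /ext_d iota_map_scale ?iota_map_z//; exact: hu.1.
Qed.

Definition ext_functor : functor (ModFin k) (HolReg q).
Proof.
exists (fun N => exist _ (ext_obj N) (ext_reg N) : HolReg q)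
  (fun M N u => exist _ (iota_map (sval u)) (ext_hom (svalP u))).
- move=> N; apply: concrete_homP; apply/funext; exact: iota_map1.
- move=> N1 N2 N3 u v; apply: concrete_homP; apply/funext.
  exact: (iota_mapM (svalP u) (svalP v)).
Defined.

Section Evaluation.
Variables (F : DKmodule k) (F_reg : reg_sing q F).

Definition eval_geneigen : ktensor (geneigen_obj F_reg) -> F :=
  kmult (fun v : geneigen F => v : F).

Lemma eval_geneigen_pure f (v : geneigen F) :
  eval_geneigen (kpure f v) = f *: (v : F).
Proof. exact: (kmult_pure (@geneigen_val_linear F)). Qed.

Lemma eval_geneigen_linear : linear eval_geneigen.
Proof. exact: (kmult_linear (@geneigen_val_linear F)). Qed.

Lemma eval_geneigen_bij : bijective eval_geneigen.
Proof.
have [d [w [n [w_bij wF_bij _]]]] := genker_basis F_reg.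
exact: (kmult_bij w_bij (@geneigen_val_linear F) wF_bij).
Qed.

Lemma eval_geneigen_z x : eval_geneigen (iota_z c x) = DKz e (eval_geneigen x).
Proof.
have mD := linear_funD eval_geneigen_linear.
move: x; apply: ktensor_ind => [x y IHx IHy|f v].
  by rewrite iota_zD !mD IHx IHy /DKz /DKtheta DKdD !scalerDr.
rewrite iota_z_pure mD !eval_geneigen_pure; exact/esym/(DKz_scale cE).
Qed.

Fact eval_geneigen_hom :
  @DKhom k (ext_obj (geneigen_obj F_reg)) F eval_geneigen.
Proof.
split=> [|x]; first exact: eval_geneigen_linear.
rewrite /= /ext_d (linear_funZ eval_geneigen_linear) eval_geneigen_z.
rewrite /DKz /DKtheta !scalerA mulr_algl -scalerAl -scalerAr.
by rewrite scalerA ee scale1r -lmonoD scale1r.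
Qed.

End Evaluation.
Arguments eval_geneigen {F} F_reg x.
Arguments eval_geneigen_linear {F} F_reg.
Arguments eval_geneigen_bij {F} F_reg.
Arguments eval_geneigen_z {F} F_reg.
Arguments eval_geneigen_hom {F} F_reg.

Lemma eval_geneigen_natural (F F' : DKmodule k) (rF : reg_sing q F)
    (rF' : reg_sing q F') (f : F -> F') (hf : DKhom f) x :
  f (eval_geneigen rF x) =
  eval_geneigen rF' (iota_map (geneigen_map hf :
    geneigen_obj rF -> geneigen_obj rF') x).
Proof.
have hg := geneigen_map_hom hf rF rF'.
move: x; apply: ktensor_ind => [x y IHx IHy|g v].
  rewrite (linear_funD (eval_geneigen_linear _)) (linear_funD hf.1) IHx IHy.
  rewrite -(linear_funD (eval_geneigen_linear _)); congr (eval_geneigen _ _).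
  exact/esym/(linear_funD (iota_map_tlinear hg.1)).
rewrite eval_geneigen_pure (DKhomZ _ _ hf) iota_map_pure; last exact: hg.1.
by rewrite eval_geneigen_pure.
Qed.

(** In one direction the isomorphism is the multiplication map
    $k((t)) \otimes N(F) \to F$; in the other it is the degree zero
    coefficient, which identifies the generalized eigenspace $1 \otimes N$ of
    $k((t)) \otimes N$ with $N$. *)
Lemma geneigen_equivalence : is_equivalence geneigen_functor.
Proof.
exists ext_functor; split.
  constructor; exists (fun F : HolReg q =>
      exist _ (eval_geneigen (svalP F)) (eval_geneigen_hom (svalP F)) :
        @Defs.hom (HolReg q) (ext_functor (geneigen_functor F)) F).
    move=> F F' u; apply: concrete_homP; apply/funext => x /=.
    exact: eval_geneigen_natural.
  move=> F; have [|g gP] := @DK_bij_iso k (ext_obj (geneigen_obj (svalP F)))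
    (sval F) (exist _ _ (eval_geneigen_hom (svalP F))).
    exact: eval_geneigen_bij.
  by exists g.
have res_lin (N : nilmodule k) :
    linear (fun x : geneigen (ext_obj N) => kres (x : ext_obj N) : N).
  by move=> a x y; rewrite -kres_linear.
have resK (N : nilmodule k) (x : geneigen (ext_obj N)) :
    kpure 1 (kres (x : ext_obj N)) = x :> ext_obj N.
  by have [n xn] := genkerP x; exact: geneigen_kres xn.
have res_hom (N : nilmodule k) : @nilhom k (geneigen_obj (ext_reg N)) N
    (fun x : geneigen (ext_obj N) => kres (x : ext_obj N)).
  split=> [|x]; first exact: res_lin.
  by rewrite /= -[in LHS](resK N x) ext_T_pure1 kres_pure1.
constructor; exists (fun N : nilmodule k => exist _ _ (res_hom N) :
    @Defs.hom (ModFin k) (geneigen_functor (ext_functor N)) N).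
  move=> M N u; apply: concrete_homP; apply/funext => x /=.
  have lu := (svalP u).1.
  by rewrite -[in RHS](resK M x) iota_map_pure// kres_pure1.
move=> N; apply: nil_bij_iso => /=.
have oneP (m : N) : (kpure 1 m : ext_obj N) \in
    gker (@DKpi_linear k e p (ext_obj N)).
  apply/(gkerP (@DKpi_linear k e p (ext_obj N))); have [n nN] := Nnil N.
  by exists n; rewrite iter_ext_T_pure1 nN (linear_fun0 (kpure_linear 1)).
exists (fun m => mk_geneigen (oneP m)) => [x|m]; last exact: kres_pure1.
by apply: val_inj; exact: resK.
Qed.

(** The comparison is the inverse of the multiplication map; its naturality and
    its compatibility with $z$ are those of the multiplication map. *)
Lemma geneigen_comparison :
  exists eta : forall F : HolReg q,
      DKcar (sval F) -> ktensor (Ncar (geneigen_functor F)),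
    [/\ forall F, linear (eta F), forall F, bijective (eta F),
        forall F v, eta F (DKz e v) = iota_z c (eta F v) &
        forall (F F' : HolReg q) (u : Defs.hom F F') v,
          iota_map (sval (Defs.fmap geneigen_functor u)) (eta F v) =
          eta F' (sval u v)].
Proof.
have inv (F : HolReg q) : exists g, cancel (eval_geneigen (svalP F)) g /\
    cancel g (eval_geneigen (svalP F)).
  by have [g gK Kg] := eval_geneigen_bij (svalP F); exists g.
pose eta F := sval (cid (inv F)).
have etaK F : cancel (eval_geneigen (svalP F)) (eta F).
  by case: (svalP (cid (inv F))).
have Keta F : cancel (eta F) (eval_geneigen (svalP F)).
  by case: (svalP (cid (inv F))).
exists eta; split=> [F|F|F v|F F' u v].
- exact: linear_can (eval_geneigen_linear (svalP F)) (etaK F) (Keta F).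
- by exists (eval_geneigen (svalP F)).
- by apply: (can_inj (etaK F)); rewrite eval_geneigen_z !Keta.
- apply: (can_inj (etaK F')); rewrite Keta -[in RHS](Keta F v).
  exact/esym/eval_geneigen_natural.
Qed.

(** * The degree zero part of a morphism *)

(** A $k$-linear map commuting with $z$ preserves generalized eigenspaces, hence
    maps $1 \otimes M$ to $1 \otimes N$. *)
Section DegreeZero.
Variables (M N : nilmodule k) (f : ktensor M -> ktensor N).
Hypothesis f_linear : linear (f : restr (ktensor M) -> restr (ktensor N)).
Hypothesis f_z : forall x, f (iota_z c x) = iota_z c (f x).

Definition deg0 (m : M) : N := kres (f (kpure 1 m)).

Fact deg0_iter n x :
  f (iter n T (x : ext_obj M)) = iter n T (f x : ext_obj N).
Proof.
elim: n => //= n <-; rewrite /DKpi !ext_z [LHS](linear_funB f_linear).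
by rewrite f_z; congr (_ - _); exact: (linear_funZ f_linear).
Qed.

Lemma deg0P m : f (kpure 1 m) = kpure 1 (deg0 m).
Proof.
have [n nM] := Nnil M; apply/esym/(@geneigen_kres N n).
rewrite -deg0_iter iter_ext_T_pure1 nM (linear_fun0 (kpure_linear 1)).
exact: (linear_fun0 f_linear).
Qed.

Lemma deg0_hom : nilhom deg0.
Proof.
split=> [a m m'|m].
  by rewrite /deg0 kpure_linear [f _]f_linear kres_linear.
rewrite /deg0 -ext_T_pure1 (deg0_iter 1) /= deg0P ext_T_pure1.
by rewrite !kres_pure1.
Qed.

Lemma deg0_bij : bijective f -> bijective deg0.
Proof.
move=> [g fK gK].
have ex m' : exists m, kpure 1 m = g (kpure 1 m').
  have [n nN] := Nnil N.
  have [|m] := @ext_geneigen M n (g (kpure 1 m')); last by exists m.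
  apply: (can_inj fK); rewrite deg0_iter gK iter_ext_T_pure1 nN.
  rewrite (linear_fun0 (kpure_linear 1)); exact/esym/(linear_fun0 f_linear).
have /choice[h hP] := ex; exists h => [m|m'].
  by rewrite -[LHS]kres_pure1 hP -deg0P fK kres_pure1.
by rewrite /deg0 hP gK kres_pure1.
Qed.

End DegreeZero.

(** A nilpotent module is recovered from its extension as the generalized
    eigenspace of $z$ at $p$. *)
Lemma deg0_nat_iso (C : category) (E E' : functor C (ModFin k))
    (psi : forall A : C, ktensor (Ncar (E A)) -> ktensor (Ncar (E' A))) :
    (forall A, linear (psi A : restr (ktensor (Ncar (E A))) ->
                               restr (ktensor (Ncar (E' A))))) ->
    (forall A x, psi A (iota_z c x) = iota_z c (psi A x)) ->
    (forall A, bijective (psi A)) ->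
    (forall A B (u : Defs.hom A B) x,
       iota_map (sval (Defs.fmap E' u)) (psi A x) =
       psi B (iota_map (sval (Defs.fmap E u)) x)) ->
  inhabited (nat_iso E E').
Proof.
move=> psi_lin psi_z psi_bij psi_nat; constructor.
exists (fun A => exist _ _ (deg0_hom (psi_lin A) (psi_z A)) :
   @Defs.hom (ModFin k) (E A) (E' A)).
  move=> A B u; apply: concrete_homP; apply/funext => m /=.
  have lu := (svalP (Defs.fmap E u)).1; have lu' := (svalP (Defs.fmap E' u)).1.
  rewrite -[LHS]kres_pure1 -(iota_map_pure 1 _ lu') -deg0P// psi_nat.
  by rewrite iota_map_pure.
by move=> A; apply: nil_bij_iso; exact: deg0_bij.
Qed.

End Equivalence.

(** * The two local Mellin transforms *)

Section LocalMellin.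
Variables (k : fieldType) (p : k).
Local Notation K := (laurent k).
Hypothesis char0 : [pchar k] =i pred0.

Let right_coef (n : int) := p + n%:~R.
Let left_coef (n : int) := p + (- n)%:~R.

Let right_ee : 1 * 1 = 1 :> k. Proof. exact: mulr1. Qed.
Let right_qE : p = 1 * p. Proof. by rewrite mul1r. Qed.
Let right_cE n : right_coef n = p + 1 * n%:~R.
Proof. by rewrite mul1r. Qed.

Let left_ee : (-1) * (-1) = 1 :> k. Proof. by rewrite mulrNN mulr1. Qed.
Let left_qE : - p = (-1) * p. Proof. by rewrite mulN1r. Qed.
Let left_cE n : left_coef n = p + (-1) * n%:~R.
Proof. by rewrite mulN1r -rmorphN. Qed.

Lemma mellin0_exists : exists E : functor (HolReg p) (ModFin k),
  is_equivalence E /\ is_mellin0 E.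
Proof.
exists (geneigen_functor char0 right_ee right_qE right_cE).
split; first exact: geneigen_equivalence.
have [eta [eta_lin eta_bij eta_z eta_nat]] :=
  geneigen_comparison char0 right_ee right_qE right_cE.
have eta_hom F : @Deltahom k (mellin_forget0 p F)
    (iota_right p (geneigen_functor char0 right_ee right_qE right_cE F)) (eta F).
  split=> [a u v|v|v] /=; last exact: linear_funZ.
    by rewrite !restr_scaleE eta_lin.
  by rewrite -eta_z /DKz !scale1r.
unshelve eexists.
  exists (fun F => exist _ (eta F) (eta_hom F)) => [F F' u|F].
    by apply: concrete_homP; apply/funext => v; exact: eta_nat.
  by apply/Delta_bij_iso; exact: eta_bij.
by move=> F; exact: (linear_homeomorphism (eta_lin F) (eta_bij F)).
Qed.

Lemma mellinoo_exists : exists E : functor (HolReg (- p)) (ModFin k),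
  is_equivalence E /\ is_mellinoo E.
Proof.
exists (geneigen_functor char0 left_ee left_qE left_cE).
split; first exact: geneigen_equivalence.
have [eta [eta_lin eta_bij eta_z eta_nat]] :=
  geneigen_comparison char0 left_ee left_qE left_cE.
have eta_hom F : @Deltahom k (mellin_forgetoo p F)
    (iota_left p (geneigen_functor char0 left_ee left_qE left_cE F)) (eta F).
  split=> [a u v|v|v] /=; last exact: linear_funZ.
    by rewrite !restr_scaleE eta_lin.
  rewrite -eta_z /DKz /DKtheta scalerN.
  by rewrite [lmono k (-1) *: _]scalerA -lmonoD !scaleN1r.
unshelve eexists.
  exists (fun F => exist _ (eta F) (eta_hom F)) => [F F' u|F].
    by apply: concrete_homP; apply/funext => v; exact: eta_nat.
  by apply/Delta_bij_iso; exact: eta_bij.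
by move=> F; exact: (linear_homeomorphism (eta_lin F) (eta_bij F)).
Qed.

(** The functor $\iota_{p!}^{\to}$ can be cancelled, and likewise
    $\iota_{p!}^{\leftarrow}$ below: a module is the generalized eigenspace of
    its image, which any $\Delta$-linear isomorphism preserves. *)
Lemma iota_right_cancel (C : category) (E E' : functor C (ModFin k)) :
  nat_iso (functor_comp (iota_right p) E) (functor_comp (iota_right p) E') ->
  inhabited (nat_iso E E').
Proof.
move=> psi.
pose f A : ktensor (Ncar (E A)) -> ktensor (Ncar (E' A)) := sval (psi A).
apply: (deg0_nat_iso char0 right_ee right_cE (psi := f)) => [A|A x|A|A B u x].
- by case: (svalP (psi A)).
- by case: (svalP (psi A)) => _ fz _; exact: fz.
- exact: (Delta_bij_iso (psi A)).2 (niso_iso psi A).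
- exact: (congr1 (fun h : {h | @Deltahom k (iota_right_obj p (E A))
    (iota_right_obj p (E' B)) h} => sval h x) (niso_natural psi u)).
Qed.

Lemma iota_left_cancel (C : category) (E E' : functor C (ModFin k)) :
  nat_iso (functor_comp (iota_left p) E) (functor_comp (iota_left p) E') ->
  inhabited (nat_iso E E').
Proof.
move=> psi.
pose f A : ktensor (Ncar (E A)) -> ktensor (Ncar (E' A)) := sval (psi A).
apply: (deg0_nat_iso char0 left_ee left_cE (psi := f)) => [A|A x|A|A B u x].
- by case: (svalP (psi A)).
- by case: (svalP (psi A)) => _ fz _; exact: fz.
- exact: (Delta_bij_iso (psi A)).2 (niso_iso psi A).
- exact: (congr1 (fun h : {h | @Deltahom k (iota_left_obj p (E A))
    (iota_left_obj p (E' B)) h} => sval h x) (niso_natural psi u)).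
Qed.

Lemma mellin0_unique (E E' : functor (HolReg p) (ModFin k)) :
  is_mellin0 E -> is_mellin0 E' -> inhabited (nat_iso E E').
Proof.
move=> [eta _] [eta' _]; have [psi] := nat_iso_quotient eta eta'.
exact: iota_right_cancel psi.
Qed.

Lemma mellinoo_unique (E E' : functor (HolReg (- p)) (ModFin k)) :
  is_mellinoo E -> is_mellinoo E' -> inhabited (nat_iso E E').
Proof.
move=> [eta _] [eta' _]; have [psi] := nat_iso_quotient eta eta'.
exact: iota_left_cancel psi.
Qed.

End LocalMellin.

Theorem theorem2 (R : realType) (p : R[i]) :
  ((exists E : functor (HolReg p) (ModFin R[i]),
      is_equivalence E /\ is_mellin0 E) /\
   (forall E E' : functor (HolReg p) (ModFin R[i]),
      is_mellin0 E -> is_mellin0 E' -> inhabited (nat_iso E E')))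
  /\
  ((exists E : functor (HolReg (- p)) (ModFin R[i]),
      is_equivalence E /\ is_mellinoo E) /\
   (forall E E' : functor (HolReg (- p)) (ModFin R[i]),
      is_mellinoo E -> is_mellinoo E' -> inhabited (nat_iso E E'))).
Proof.
have char0 : [pchar R[i]] =i pred0 by exact: pchar_num.
split; split.
- exact: mellin0_exists.
- exact: mellin0_unique.
- exact: mellinoo_exists.
- exact: mellinoo_unique.
Qed.
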